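(* Let $d\geq 1$ be an integer and let $A\subset[0,d]$ be a non-empty analytic set which contains its infimum and supremum. Then there exists a compact set $K\subset\mathbb{R}^d$ with $$\{\dim_P E: E\in\mathcal{M}_K\}=A.$$
   Context: For a compact set $K\subset\mathbb{R}^d$, a set $E$ is a microset of $K$ if $E\cap(0,1)^d\neq\emptyset$ and there exist maps $S_n\colon\mathbb{R}^d\to\mathbb{R}^d$, $S_n(z)=\lambda_n z+u_n$, with $\lambda_n\geq 1$ and $u_n\in\mathbb{R}^d$, such that $S_n(K)\cap[0,1]^d$ converges to $E$ in the Hausdorff metric (on non-empty compact sets). $\mathcal{M}_K$ denotes the set of all microsets of $K$. A set $A\subset\mathbb{R}$ is analytic if it is the image of a Polish space under a continuous map. For a metric space $X$ let $N_n(X)$ be the minimal number of closed balls of radius at most $2^{-n}$ needed to cover $X$, and $\overline{\dim}_B\,X=\limsup_{n\to\infty}\frac{\log N_n(X)}{n\log 2}$. The packing dimension is $\dim_P X=\inf\{\sup_i\overline{\dim}_B\,E_i: X=\bigcup_{i=1}^\infty E_i\}$. *)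

(* Defs.v *)
From HB Require Import structures.
From mathcomp Require Import all_boot all_order all_algebra.
From mathcomp Require Import all_classical all_reals all_analysis.

Set Implicit Arguments.
Unset Strict Implicit.
Unset Printing Implicit Defensive.

Import Order.TTheory GRing.Theory Num.Theory.
Import numFieldNormedType.Exports.

Local Open Scope classical_set_scope.
Local Open Scope ring_scope.

(* The library norm on 'rV[R]_d is the sup norm; it induces the same topology
   as [l2dist], but balls and Hausdorff distances below are Euclidean. *)
Definition l2dist (R : realType) (d : nat) (x y : 'rV[R]_d) : R :=
  Num.sqrt (\sum_(i < d) (x ord0 i - y ord0 i) ^+ 2).

(* The real-valued [sup] and [inf] are only meaningful on non-empty bounded
   sets, which covers the case of non-empty compact [A] and [B]. *)
Definition hausdorff_dist (R : realType) (d : nat) (A B : set 'rV[R]_d) : R :=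
  Num.max (sup [set inf [set l2dist a b | b in B] | a in A])
          (sup [set inf [set l2dist a b | a in A] | b in B]).

Definition unit_cube (R : realType) (d : nat) : set 'rV[R]_d :=
  [set z | forall i, 0 <= z ord0 i <= 1].

Definition open_unit_cube (R : realType) (d : nat) : set 'rV[R]_d :=
  [set z | forall i, 0 < z ord0 i < 1].

(* Compactness of [E] and non-emptiness of the truncated images place the
   convergence in the space of non-empty compact sets. *)
Definition is_microset (R : realType) (d : nat) (K E : set 'rV[R]_d) : Prop :=
  [/\ compact E, E `&` @open_unit_cube R d !=set0 &
    exists (lam : nat -> R) (u : nat -> 'rV[R]_d),
      let KS n := [set lam n *: z + u n | z in K] `&` @unit_cube R d in
      [/\ forall n, 1 <= lam n,
          forall n, KS n !=set0 &
          hausdorff_dist (KS n) E @[n --> \oo] --> (0 : R)]].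

Definition microsets (R : realType) (d : nat) (K : set 'rV[R]_d) :
  set (set 'rV[R]_d) := [set E | is_microset K E].

(* [X] is regarded as a metric space on its own, so balls are centred in [X].
   The value is [+oo] when no finite cover exists. *)
Definition covering_number (R : realType) (d : nat) (X : set 'rV[R]_d)
    (n : nat) : \bar R :=
  ereal_inf [set (k%:R : R)%:E | k in [set k : nat |
    exists (c : 'I_k -> 'rV[R]_d) (r : 'I_k -> R),
      (forall i, X (c i) /\ 0 < r i <= 2 ^- n) /\
      (forall x, X x -> exists i, l2dist (c i) x <= r i)]].

Definition upper_box_dim (R : realType) (d : nat) (X : set 'rV[R]_d) : \bar R :=
  limn_esup (fun n : nat =>
    (lne (covering_number X n) / ((n%:R * ln 2)%R%:E))%E).

Definition packing_dim (R : realType) (d : nat) (X : set 'rV[R]_d) : \bar R :=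
  ereal_inf [set ereal_sup (range (fun i : nat => upper_box_dim (F i))) |
             F in [set F : nat -> set 'rV[R]_d | X = \bigcup_i F i]].

Definition separable (T : topologicalType) : Prop :=
  exists2 D : set T, countable D & dense D.

Definition complete_space (T : uniformType) : Prop :=
  forall F : set_system T, ProperFilter F -> cauchy F -> exists x : T, F --> x.

(* Polish spaces are exactly the topological spaces underlying the separable
   complete metric spaces. *)
Definition analytic (R : realType) (A : set R) : Prop :=
  exists (T : metricType R) (f : T -> R),
    [/\ complete_space T, separable T, continuous f & range f = A].

(* Main.v *)
(* Let K be the set of the points of [0,1]^d all of whose coordinates have binary
   digits supported on a fixed set D of positions.  A microset E of K is a limit
   of windows of K at scales 2^-(p j); along an ultrafilter the shifts of D by p j
   converge to a set D', and E looks at every point of the open cube like the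
   digit set of D'.  Counting dyadic cells bounds the upper box dimension of E by
   d times the upper density of D', and a Baire category argument gives the same
   lower bound for the packing dimension.

   Hence it suffices to find D such that the upper densities of the limits of its
   shifts are exactly the x/d with x in A.  Positions are chosen with local rate
   inf A/d or sup A/d according to a sequence b of 0s and 1s, made of blocks, one
   for each finite code of a point of the Polish space mapped onto A.  In a block,
   successive runs of 1s are separated by fast growing gaps and bring the prefix
   density to the values prescribed by the prefixes of the code.  A limit of
   shifts of b is eventually constant (giving inf A or sup A), or a tail of b or
   the word of a finite code (density 0, giving inf A), or the word of an
   infinite code, whose upper density corresponds to a point of A; any point of A
   occurs. *)
Require Import Defs.
From mathcomp Require Import all_boot all_order all_algebra.
From mathcomp Require Import all_classical all_reals all_analysis.
From mathcomp Require Import zify ring lra.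
Import Order.TTheory GRing.Theory Num.Theory.
Import numFieldNormedType.Exports.
Local Open Scope classical_set_scope.
Local Open Scope ring_scope.

Set Implicit Arguments.
Unset Strict Implicit.
Unset Printing Implicit Defensive.

(** * Upper density of code words *)

Definition count_below (b : nat -> bool) (n : nat) : nat := (\sum_(i < n) b i)%N.

Arguments count_below b n%_N.

(** The limsup of [count_below b n / n] is [v], multiplied out so that no division by [n] and no
    limsup has to be handled. *)
Definition upper_density (R : realType) (b : nat -> bool) (v : R) : Prop :=
  (forall e : R, 0 < e -> exists N : nat, forall n : nat, (N <= n)%N ->
     (count_below b n)%:R <= (v + e) * n%:R) /\
  (forall (e : R) (N : nat), 0 < e -> exists2 n : nat, (N <= n)%N &
     (v - e) * n%:R <= (count_below b n)%:R).

Lemma count_below0 b : count_below b 0 = 0%N.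
Proof. by rewrite /count_below big_ord0. Qed.

Lemma count_belowS (b : nat -> bool) n : count_below b n.+1 = (count_below b n + b n)%N.
Proof. by rewrite /count_below big_ord_recr. Qed.

Lemma count_belowD (b : nat -> bool) m n :
  count_below b (m + n)%N = (count_below b m + count_below (fun i => b (m + i)%N) n)%N.
Proof.
elim: n => [|n IHn]; first by rewrite !addn0 count_below0 ?addn0.
by rewrite addnS !count_belowS IHn addnA.
Qed.

Lemma count_below_le (b : nat -> bool) n : (count_below b n <= n)%N.
Proof.
elim: n => [|n IHn]; first by rewrite count_below0.
by rewrite count_belowS; case: (b n); lia.
Qed.

Lemma eq_count_below b c n : (forall i, (i < n)%N -> b i = c i) ->
  count_below b n = count_below c n.
Proof. by move=> bc; apply: eq_bigr => i _; rewrite bc. Qed.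

Lemma count_below_eq0 (b : nat -> bool) n : (forall i, (i < n)%N -> ~~ b i) -> count_below b n = 0%N.
Proof. by move=> b0; rewrite /count_below big1 // => i _; rewrite (negbTE (b0 i _)). Qed.

Lemma count_below_true (b : nat -> bool) n : (forall i, (i < n)%N -> b i) -> count_below b n = n.
Proof.
move=> b1; rewrite (@eq_count_below _ (fun=> true)); last exact: b1.
by rewrite /count_below sum_nat_const card_ord muln1.
Qed.

Lemma count_below_supp (b : nat -> bool) s n : (forall i, (s <= i < n)%N -> ~~ b i) ->
  (count_below b n <= s)%N.
Proof.
move=> bs; have [ns|sn] := leqP n s; first exact: leq_trans (count_below_le _ _) ns.
rewrite -(subnKC (ltnW sn)) count_belowD [X in (_ + X)%N]count_below_eq0.
  by rewrite addn0 count_below_le.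
by move=> i ilt; apply: bs; lia.
Qed.

(** A bounded discrepancy [C] is eventually below [e / 2 * n], so it does not affect the density. *)
Lemma upper_density_close (R : realType) (b c : nat -> bool) (C : nat) (v : R) :
  (forall n, (count_below b n <= count_below c n + C)%N) ->
  (forall n, (count_below c n <= count_below b n + C)%N) ->
  upper_density b v -> upper_density c v.
Proof.
move=> bc cb [ub lb].
have large (e : R) : 0 < e -> exists N : nat, forall n : nat, (N <= n)%N -> C%:R <= e * n%:R.
  move=> e0; exists (Num.truncn (C%:R / e)).+1 => n Nn.
  rewrite mulrC -ler_pdivrMr //.
  have /andP[_ /ltW] := truncn_itv (divr_ge0 (ler0n R C) (ltW e0)).
  by move=> /le_trans; apply; rewrite ler_nat.
split=> [e e0|e N e0].
  have e20 : 0 < e / 2 by rewrite divr_gt0.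
  have [N1 hN1] := ub _ e20; have [N2 hN2] := large _ e20.
  exists (maxn N1 N2) => n; rewrite geq_max => /andP[/hN1 h1 /hN2 h2].
  have : (count_below c n)%:R <= (count_below b n)%:R + C%:R :> R.
    by rewrite -natrD ler_nat.
  by nra.
have e20 : 0 < e / 2 by rewrite divr_gt0.
have [N2 hN2] := large _ e20; have [n] := lb _ (maxn N N2) e20.
rewrite geq_max => /andP[Nn /hN2 h2] h1; exists n => //.
have : (count_below b n)%:R <= (count_below c n)%:R + C%:R :> R.
  by rewrite -natrD ler_nat.
by nra.
Qed.

Lemma upper_density_shift (R : realType) (b : nat -> bool) (s : nat) (v : R) :
  upper_density b v <-> upper_density (fun i => b (s + i)%N) v.
Proof.
have h1 n : (count_below b n <= count_below (fun i => b (s + i)%N) n + s)%N.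
  have /= := count_belowD b n s; rewrite addnC count_belowD.
  by have := count_below_le b s; lia.
have h2 n : (count_below (fun i => b (s + i)%N) n <= count_below b n + s)%N.
  have /= := count_belowD b n s; rewrite addnC count_belowD.
  by have := count_below_le (fun i => b (n + i)%N) s; lia.
by split; apply: (@upper_density_close _ _ _ s).
Qed.

Lemma upper_density_const (R : realType) (c : bool) :
  upper_density (fun=> c) (c%:R : R).
Proof.
have E n : count_below (fun=> c) n = (c * n)%N.
  by rewrite /count_below sum_nat_const card_ord mulnC.
split=> [e e0|e N e0]; first by exists 0%N => n _; rewrite E natrM ler_wpM2r// lerDl ltW.
by exists N => //; rewrite E natrM ler_wpM2r// gerBl ltW.
Qed.

Lemma upper_density_ev_const (R : realType) (b : nat -> bool) (c : bool) (N : nat) :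
  (forall i, (N <= i)%N -> b i = c) -> upper_density b (c%:R : R).
Proof.
move=> bN; apply/(@upper_density_shift _ _ N).
by rewrite (_ : (fun i => _) = fun=> c) //; [exact: upper_density_const |
  apply/funext => i; rewrite bN // leq_addr].
Qed.

(** * Words attached to finite and infinite codes, and their densities *)

Section Codes.
Context (R : realType) (v : seq nat -> R).
Hypothesis v01 : forall w, 0 <= v w <= 1.
Implicit Types (w u t : seq nat) (x : nat -> nat).

(* A code is a list of symbols, the newest first.  It is turned into a 0-1 word
   with one run of ones per symbol: the run of k :: w ends at code_end (k :: w),
   where the prefix density comes close to v (k :: w). *)
Fixpoint code_end w : nat :=
  if w is k :: w' then ((size w').+2 ^ 2 * (code_end w' + k).+1)%N else 0%N.

(* Capping the density at 1 - 1/(size w + 1) leaves room for a long gap before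
   the run. *)
Definition run_length w : nat :=
  Num.truncn (Num.min (v w) (1 - (size w).+1%:R^-1) * (code_end w)%:R).

Definition run_start w : nat := (code_end w - run_length w)%N.

Fixpoint code_word w (i : nat) : bool :=
  if w is k :: w' then (run_start w <= i < code_end w)%N || code_word w' i
  else false.

Lemma run_length_itv w :
  Num.min (v w) (1 - (size w).+1%:R^-1) * (code_end w)%:R - 1 <= (run_length w)%:R /\
  (run_length w)%:R <= Num.min (v w) (1 - (size w).+1%:R^-1) * (code_end w)%:R.
Proof.
have h : 0 <= Num.min (v w) (1 - (size w).+1%:R^-1) * (code_end w)%:R.
  rewrite mulr_ge0// le_min; have /andP[-> _] /= := v01 w.
  by rewrite subr_ge0 invf_le1// ler1n.
have /andP[h1 h2] := truncn_itv h; split => //.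
by rewrite lerBlDr natr1; exact: ltW.
Qed.

Lemma run_startD w : (run_start w + run_length w = code_end w)%N.
Proof.
rewrite subnK // -(ler_nat R); have [_ /le_trans] := run_length_itv w; apply.
rewrite ler_piMl// ge_min; by have /andP[_ ->] := v01 w.
Qed.

(** With r = [(size w).+2] and X = [(code_end w + k).+1], the run ends at r^2 X and the cap limits
    its length to (1 - 1/r) r^2 X, so at least r X places precede it. *)
Lemma run_start_ge k w : ((size w).+2 * (code_end w + k).+1 <= run_start (k :: w))%N.
Proof.
set X := (code_end w + k).+1; set r := (size w).+2.
have [_ h] := run_length_itv (k :: w).
have rR : (0 : R) < r%:R by rewrite ltr0n.
have EE : code_end (k :: w) = (r * (r * X))%N by rewrite /= mulnA.
have : (run_length (k :: w))%:R <= (1 - r%:R^-1) * (code_end (k :: w))%:R :> R.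
  by rewrite (le_trans h)// ler_wpM2r// ge_min lexx orbT.
rewrite mulrBl mul1r {2}EE natrM mulKf ?gt_eqF// lerBrDr -natrD ler_nat.
by have := run_startD (k :: w); lia.
Qed.

Lemma run_start_gt k w : (code_end w + k < run_start (k :: w))%N.
Proof. by apply: leq_trans (run_start_ge k w); rewrite leq_pmull. Qed.

Lemma run_start_le w : (run_start w <= code_end w)%N.
Proof. exact: leq_subr. Qed.

Lemma code_end_cons k w : (code_end w + k < code_end (k :: w))%N.
Proof. by rewrite /= leq_pmull. Qed.

Lemma code_end_cat t w : (code_end w <= code_end (t ++ w))%N.
Proof. by elim: t => //= k t IHt; apply: leq_trans IHt _; have := code_end_cons k (t ++ w) => /=; lia. Qed.

Lemma code_word_lt w i : code_word w i -> (i < code_end w)%N.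
Proof.
elim: w => [//|k w IHw]; rewrite [code_word _ _]/= => /orP[/andP[_ ->]//|/IHw].
by have := code_end_cons k w; lia.
Qed.

Lemma code_word_run w i : (0 < size w)%N -> (i < run_length w)%N ->
  code_word w (run_start w + i)%N.
Proof.
case: w => // k w _ ilt; apply/orP; left; rewrite leq_addr.
by rewrite -(run_startD (k :: w)) ltn_add2l.
Qed.

(** Symbols added later only put ones further to the right, so every code that continues [w] by [k]
    shows the word of [w] up to the run of [k]. *)
Lemma code_word_cat t k w i : (i < run_start (k :: w))%N ->
  code_word (t ++ k :: w) i = code_word w i.
Proof.
move=> ilt; elim: t => [|a t IHt] /=.
  by rewrite leqNgt ilt.
rewrite IHt leqNgt (_ : (i < _)%N = true) //.
have := run_start_gt a (t ++ k :: w); have := code_end_cat t (k :: w).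
by have := run_start_le (k :: w); lia.
Qed.

Lemma code_word_cat_end t w i : (i < code_end w)%N -> code_word (t ++ w) i = code_word w i.
Proof.
elim/last_ind: t => [//|t k _] ilt; rewrite cat_rcons code_word_cat //.
by have := run_start_gt k w; lia.
Qed.

Fixpoint prefix_code x r : seq nat := if r is r'.+1 then x r' :: prefix_code x r' else [::].

(** The first [i.+1] symbols settle position [i]: a prefix of length r has [code_end] at least r,
    and later runs start beyond that. *)
Definition inf_word x i : bool := code_word (prefix_code x i.+1) i.

Lemma size_prefix_code x r : size (prefix_code x r) = r.
Proof. by elim: r => //= r ->. Qed.

Lemma prefix_code_cat x r m : exists t, prefix_code x (m + r)%N = t ++ prefix_code x r.
Proof.
elim: m => [|m [t IHm]]; first by exists [::].
by exists (x (m + r)%N :: t); rewrite addSn /= IHm.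
Qed.

Lemma code_end_prefix x r : (r <= code_end (prefix_code x r))%N.
Proof. by elim: r => // r IHr; have := code_end_cons (x r) (prefix_code x r); rewrite -/(prefix_code x r.+1); lia. Qed.

Lemma inf_wordE x r i : (i < run_start (prefix_code x r.+1))%N ->
  inf_word x i = code_word (prefix_code x r) i.
Proof.
move=> ilt; rewrite /inf_word; have [ri|ir] := leqP r i.
  have [t] := prefix_code_cat x r.+1 (i - r); rewrite addnS subnK // => ->.
  exact: code_word_cat.
have [t] := prefix_code_cat x i.+1 (r - i.+1); rewrite subnK // => ->.
by rewrite code_word_cat_end // code_end_prefix.
Qed.

Lemma inf_wordE_end x r i : (i < code_end (prefix_code x r))%N ->
  inf_word x i = code_word (prefix_code x r) i.
Proof.
move=> ilt; apply: inf_wordE; rewrite /=.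
by have := run_start_gt (x r) (prefix_code x r); lia.
Qed.

(** The ones of [w] number at most [code_end w], a fraction [(size w).+2%:R^-1] of the run start.
    Those of the last run have a prefix density that grows along the run, is at most [v (k :: w)] at
    its end, and falls afterwards. *)
Lemma count_code_word_le k w n : (run_start (k :: w) <= n)%N ->
  (count_below (code_word (k :: w)) n)%:R <= (v (k :: w) + (size w).+2%:R^-1) * n%:R.
Proof.
move=> Bn; set B := run_start (k :: w) in Bn *; set E := code_end (k :: w).
set L := run_length (k :: w).
have BL : (B + L = E)%N := run_startD (k :: w).
have cntE s : (B <= s)%N -> (count_below (code_word (k :: w)) s <= code_end w + (s - B))%N.
  move=> Bs; rewrite -{1}(subnKC Bs) count_belowD leq_add ?count_below_le //.
  apply: count_below_supp => i /andP[ei iB] /=; rewrite -/B leqNgt iB /=.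
  by apply/negP => /code_word_lt; rewrite ltnNge ei.
have cnt_n : (count_below (code_word (k :: w)) n <= code_end w + (minn n E - B))%N.
  have [nE|En] := leqP n E; first exact: cntE.
  rewrite -(subnKC (ltnW En)) count_belowD [X in (_ + X)%N]count_below_eq0; last first.
    by move=> i _; apply/negP => /code_word_lt; rewrite ltnNge leq_addr.
  by rewrite addn0; apply: cntE; apply: run_start_le.
apply: (@le_trans _ _ ((code_end w + (minn n E - B))%N%:R)); first by rewrite ler_nat.
rewrite natrD addrC mulrDl lerD //; last first.
  rewrite mulrC ler_pdivlMr ?ltr0n // -natrM ler_nat mulnC.
  by apply: leq_trans Bn; apply: leq_trans (run_start_ge k w); rewrite leq_mul2l; lia.
have E0 : (0 < E)%N by have := code_end_cons k w; rewrite -/E; lia.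
have [_] := run_length_itv (k :: w); rewrite -/L -/E => hL.
have {}hL : L%:R <= v (k :: w) * E%:R.
  by apply: le_trans hL _; rewrite ler_wpM2r// ge_min lexx.
rewrite -(ler_pM2r (_ : 0 < E%:R)) ?ltr0n //.
apply: (@le_trans _ _ (L%:R * n%:R)).
  rewrite -!natrM ler_nat; have : (minn n E <= n)%N by apply: geq_minl.
  have : (minn n E <= E)%N by apply: geq_minr.
  have : (B <= minn n E)%N by rewrite leq_min Bn run_start_le.
  move: (minn n E) => m Bm mE mn.
  have : ((m - B) * E <= L * m)%N.
    move: mE; rewrite -BL -(subnKC Bm) addKn leq_add2l => tL.
    by rewrite !mulnDr leq_add // ?leq_mul2r ?tL ?orbT // mulnC.
  by move=> /leq_trans; apply; rewrite leq_mul2l mn orbT.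
by rewrite mulrAC ler_wpM2r.
Qed.

(** From one run start to the next, [count_code_word_le] bounds the prefix density from above. The
    bound is nearly attained at run ends, where the density is close to the capped [v], and the cap
    tends to 1. *)
Lemma upper_density_inf_word x (l : R) : v (prefix_code x r) @[r --> \oo] --> l ->
  upper_density (inf_word x) l.
Proof.
move=> vl.
have inv_small (e : R) : 0 < e -> \forall r \near \oo, r.+1%:R^-1 < e.
  by move=> e0; exact: (near_infty_natSinv_lt (PosNum e0)).
split=> [e e0|e N e0].
  have e20 : 0 < e / 2 by rewrite divr_gt0.
  have [M _ hM] : \forall r \near \oo,
      v (prefix_code x r) + r.+1%:R^-1 <= l + e.
    near=> r; have h1 : r.+1%:R^-1 < e / 2 by near: r; exact: inv_small.
    have : `|l - v (prefix_code x r)| < e / 2 by near: r; exact: cvgr_dist_lt.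
    rewrite ltr_norml => /andP[h2 h3]; move: (r.+1%:R^-1) h1 => z h1; lra.
  exists (run_start (prefix_code x M.+1)) => n Mn.
  (* The last run already started at [n]; no later symbol is visible below [n]. *)
  have [r rM /andP[rn nr]] : exists2 r, (M <= r)%N &
      (run_start (prefix_code x r.+1) <= n < run_start (prefix_code x r.+2))%N.
    pose P r := (M <= r)%N && (run_start (prefix_code x r.+1) <= n)%N.
    have exP : exists r, P r by exists M; rewrite /P leqnn.
    have bP r : P r -> (r <= n)%N.
      move=> /andP[_] /(leq_trans (ltnW (run_start_gt (x r) (prefix_code x r)))).
      by have := code_end_prefix x r; lia.
    have [r /andP[Mr rn] rmax] := ex_maxnP exP bP.
    exists r => //; rewrite rn ltnNge; apply/negP => nr.
    by have := rmax r.+1; rewrite /P nr (leqW Mr) ltnn => /(_ isT).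
  rewrite (@eq_count_below _ (code_word (prefix_code x r.+1))); last first.
    by move=> i ilt; apply: inf_wordE; apply: ltn_trans nr.
  apply: (le_trans (count_code_word_le rn)); rewrite ler_wpM2r//.
  by have := hM r.+1; rewrite /= size_prefix_code; apply; apply: leqW.
have e30 : 0 < e / 3 by rewrite divr_gt0.
near \oo => r.
exists (code_end (prefix_code x r)).
  by apply: leq_trans (code_end_prefix _ _); near: r; exact: nbhs_infty_ge.
set w := prefix_code x r.
have h1 : r.+1%:R^-1 < e / 3 by near: r; exact: inv_small.
have : `|l - v w| < e / 3 by rewrite /w; near: r; exact: cvgr_dist_lt.
rewrite ltr_norml => /andP[h2 h3].
have r0 : (0 < r)%N by near: r; exact: nbhs_infty_gt.
have rE : (run_length w <= count_below (inf_word x) (code_end w))%N.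
  rewrite (@eq_count_below _ (code_word w)); last by move=> i; apply: inf_wordE_end.
  rewrite -(run_startD w) count_belowD [X in (_ + X)%N]count_below_true ?leq_addl //.
  by move=> i; apply: code_word_run; rewrite size_prefix_code.
have E1 : 1 <= e / 3 * (code_end w)%:R.
  have rr : r.+1%:R^-1 < e / 3 := h1.
  have : r.+1%:R <= (code_end w)%:R :> R.
    rewrite ler_nat /w; case: (r) r0 => // r' _.
    by have := code_end_cons (x r') (prefix_code x r'); have := code_end_prefix x r'; rewrite /=; lia.
  move=> /(ler_wpM2l (ltW e30)); apply: le_trans.
  by rewrite -ler_pdivrMr ?ltr0n // div1r ltW.
apply: (@le_trans _ _ (run_length w)%:R); last by rewrite ler_nat.
have [h _] := run_length_itv w; apply: le_trans h.
have wE : size w = r by exact: size_prefix_code.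
(* The cap is harmless: it exceeds 1 - e/3, while l < v w + e/3 <= 1 + e/3. The remaining e/3 pays
   for the truncation, by [E1]. *)
have : l - 2 / 3 * e <= Num.min (v w) (1 - (size w).+1%:R^-1).
  rewrite le_min wE; apply/andP; split; first lra.
  by have /andP[_ ?] := v01 w; move: (r.+1%:R^-1) h1 => z h1; lra.
have : 0 <= (code_end w)%:R :> R by [].
by nra.
Unshelve. all: by end_near. Qed.

End Codes.

(** * The universal 0-1 sequence *)

(** Along an ultrafilter a sequence of naturals is either constant or divergent; this drives the
    case analysis on the position of a window. *)
Lemma ultra_nat (U : set_system nat) (f : nat -> nat) : UltraFilter U ->
  (exists c, U [set j | f j = c]) \/ (forall N, U [set j | (N <= f j)%N]).
Proof.
move=> UU; have [[c Uc]|noc] := pselect (exists c, U [set j | f j = c]).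
  by left; exists c.
right; elim=> [|N IHN]; first exact: filterE.
have [UN|UN] := in_ultra_setVsetC [set j | f j = N] UU.
  by case: noc; exists N.
by apply: filterS2 IHN UN => j /= Nj /eqP; lia.
Qed.

Lemma near_all_below (U : set_system nat) (P : nat -> nat -> Prop) (n : nat) :
  Filter U -> (forall i, U [set j | P i j]) -> U [set j | forall i, (i < n)%N -> P i j].
Proof.
move=> FU UP; elim: n => [|n IHn]; first by apply: filterE.
apply: filterS2 IHn (UP n) => j /= h hn i; rewrite ltnS leq_eqVlt => /orP[/eqP->//|].
exact: h.
Qed.

Section Blocks.
Context (R : realType) (v : seq nat -> R).
Hypothesis v01 : forall w, 0 <= v w <= 1.
Hypothesis v_cvg : forall x, exists l : R, v (prefix_code x r) @[r --> \oo] --> l.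
Implicit Types (w u t : seq nat) (x : nat -> nat) (U : set_system nat).

(** Indices that decode to nothing receive the empty code, whose block carries no ones. *)
Definition nth_code (j : nat) : seq nat := odflt [::] (unpickle j).

(* The gap before block j dwarfs everything placed earlier and the block itself,
   so that the whole sequence has density 0. *)
Fixpoint block_start (j : nat) : nat :=
  if j is j'.+1
  then (j'.+2 * (block_start j' + code_end (nth_code j') + code_end (nth_code j'.+1)).+1)%N
  else 0%N.

Fixpoint block_index (p : nat) : nat :=
  if p is p'.+1 then
    let j := block_index p' in if (block_start j.+1 <= p)%N then j.+1 else j
  else 0%N.

Definition block_word (p : nat) : bool :=
  code_word v (nth_code (block_index p)) (p - block_start (block_index p)).

Lemma block_start_gap j :
  (j.+2 * (block_start j + code_end (nth_code j) + code_end (nth_code j.+1)) + j < block_start j.+1)%N.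
Proof. by rewrite [block_start j.+1]/=; lia. Qed.

Lemma block_start_lt j :
  (block_start j + code_end (nth_code j) + code_end (nth_code j.+1) + j < block_start j.+1)%N.
Proof. by apply: leq_trans (block_start_gap j); rewrite ltnS leq_add2r leq_pmull. Qed.

Lemma block_start_homo : {homo block_start : i j / (i <= j)%N}.
Proof. by apply: homo_leq => [//|? ? ?|j]; [exact: leq_trans|have := block_start_lt j; lia]. Qed.

Lemma block_indexP p :
  (block_start (block_index p) <= p < block_start (block_index p).+1)%N.
Proof.
elim: p => [|p /andP[IH1 IH2]]; first by rewrite leqnn (leq_trans _ (block_start_lt 0)).
rewrite [block_index p.+1]/=; case: ifP => h.
  rewrite h; have := block_start_lt (block_index p).+1.
  by move: IH2; lia.
by rewrite ltnNge h andbT; apply: leqW.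
Qed.

Lemma block_indexE j p : (block_start j <= p < block_start j.+1)%N -> block_index p = j.
Proof.
move=> /andP[jp pj]; have /andP[ip pi] := block_indexP p.
apply/eqP; rewrite eqn_leq; apply/andP; split; rewrite leqNgt; apply/negP => /block_start_homo.
  by lia.
by lia.
Qed.

Lemma block_wordE j o : (block_start j + o < block_start j.+1)%N ->
  block_word (block_start j + o)%N = code_word v (nth_code j) o.
Proof.
by move=> h; rewrite /block_word (@block_indexE j) ?leq_addr // addKn.
Qed.

Lemma block_index_cvg U (p : nat -> nat) : Filter U -> (forall N, U [set j | (N <= p j)%N]) ->
  forall N, U [set j | (N <= block_index (p j))%N].
Proof.
move=> FU Up N; apply: filterS (Up (block_start N)) => j /= Nj.
rewrite leqNgt; apply/negP => /block_start_homo.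
by have /andP[_] := block_indexP (p j); lia.
Qed.

(** For [n] in block [j.+1], all ones below [n] lie among the first
    [block_start j + code_end (nth_code j)] places or in the code of the current block, and
    [block_start j.+1] is more than [j.+2] times this total. The lower bound is trivial, as [0 - e]
    is negative. *)
Lemma upper_density_block_word : upper_density block_word (0 : R).
Proof.
have bw j m i : (block_start j + m <= block_start j.+1)%N ->
    (code_end (nth_code j) <= i < m)%N -> ~~ block_word (block_start j + i)%N.
  move=> jm /andP[ei im]; rewrite block_wordE; last by lia.
  by apply/negP => /code_word_lt; lia.
have blk j m : (block_start j + m <= block_start j.+1)%N ->
    (count_below (fun i => block_word (block_start j + i)%N) m <= code_end (nth_code j))%N.
  by move=> jm; apply: count_below_supp => i; apply: bw.
have blkS j n : (block_start j.+1 <= n <= block_start j.+2)%N ->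
    (j.+2 * count_below block_word n <= n)%N.
  move=> /andP[jn nj]; apply: leq_trans (jn); apply: leq_trans (ltnW (block_start_gap j)).
  rewrite -[leqLHS]addn0 leq_add // leq_mul2l /=.
  have jS := block_start_lt j.
  rewrite -(subnKC jn) count_belowD leq_add //; last by apply: blk; lia.
  have jjS : (block_start j <= block_start j.+1)%N by lia.
  rewrite -(subnKC jjS) count_belowD leq_add // ?count_below_le //.
  by apply: blk; lia.
split=> [e e0|e N e0]; last first.
  exists N => //; apply: (@le_trans _ _ 0) => //.
  by rewrite mulr_le0_ge0 // sub0r oppr_le0 ltW.
have [M _ /(_ M (leqnn M)) /= hM] := near_infty_natSinv_lt (PosNum e0).
exists (block_start M.+1) => n Mn.
have /andP[jn nj] := block_indexP n; set j := block_index n in jn nj.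
have Mj : (M < j)%N.
  rewrite ltnNge; apply/negP => jM.
  have := block_start_homo (jM : (j.+1 <= M.+1)%N); lia.
move: Mj jn nj; case: j => // j Mj jn nj.
have := blkS j n; rewrite jn ltnW // => /(_ isT) h.
have {}h : j.+2%:R * (count_below block_word n)%:R <= n%:R :> R by rewrite -natrM ler_nat.
rewrite add0r; apply: le_trans (_ : j.+2%:R^-1 * n%:R <= _).
  by rewrite ler_pdivlMl.
rewrite ler_wpM2r //; apply: le_trans (_ : M.+1%:R^-1 <= _).
  by rewrite lef_pV2 ?posrE ?ltr0n // ler_nat; lia.
exact: ltW.
Qed.

(** [Q u] says that [U]-almost all codes begin with the symbols of [u]. If such segments can always
    be prolonged they define an infinite code whose word is [c]. Otherwise, after some [u], the next
    symbol diverges and pushes its run out of sight, so [c] has finitely many ones. *)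
Lemma code_limit U (w : nat -> seq nat) (c : nat -> bool) : UltraFilter U ->
  (forall i, U [set j | code_word v (w j) i = c i]) ->
  exists2 l : R, upper_density c l &
    l = 0 \/ exists x, v (prefix_code x r) @[r --> \oo] --> l.
Proof.
move=> UU wc; pose Q u := U [set j | exists t, w j = t ++ u].
have Q0 : Q [::] by apply: filterE => j; exists (w j); rewrite cats0.
have [Qstep|] := pselect (forall u, exists k, Q u -> Q (k :: u)).
  have [g hg] := choice Qstep.
  pose L := fix L r := if r is r'.+1 then g (L r') :: L r' else [::].
  pose x r := g (L r).
  have xL r : prefix_code x r = L r by elim: r => //= r ->.
  have QL r : Q (prefix_code x r) by rewrite xL; elim: r => //= r; exact: hg.
  have -> : c = inf_word v x.
    apply/funext => i; have [j /= [<- [t ->]]] := filter_ex (filterI (wc i) (QL i.+1)).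
    by rewrite code_word_cat_end // code_end_prefix.
  have [l vl] := v_cvg x; exists l; last by right; exists x.
  exact: upper_density_inf_word.
move=> /existsNP[u /forallNP nQ]; exists 0; last by left.
have Qu : Q u by have /not_implyP[] := nQ 0%N.
have {}nQ k : U (~` [set j | exists t, w j = t ++ k :: u]).
  by have [Uk|//] := in_ultra_setVsetC [set j | exists t, w j = t ++ k :: u] UU; case: (nQ k).
(* Almost every code stops at [u] or goes on with a symbol [k > i], and the run of [k] starts beyond
   [k]. *)
have cE i : c i = code_word v u i.
  have [j /= [[<- [t wj]] jk]] :=
    filter_ex (filterI (filterI (wc i) Qu) (near_all_below i.+1 _ nQ)).
  rewrite wj; case/lastP: t wj => [//|t k] wj.
  have ki : (i < k)%N.
    rewrite ltnNge; apply/negP => ki; case: (jk k ki).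
    by exists t; rewrite wj cat_rcons.
  rewrite cat_rcons code_word_cat //; have := run_start_gt v01 k u; lia.
apply: (@upper_density_ev_const _ _ false (code_end u)) => i ui.
by rewrite cE; apply/negP => /code_word_lt; rewrite ltnNge ui.
Qed.

(* So a window drifting away from the start of its blocks sees at most one
   run, and its limit is eventually constant. *)
Lemma code_word_gap w i1 i2 i3 : (i1 < i2 < i3)%N -> code_word v w i1 -> ~~ code_word v w i2 ->
  code_word v w i3 -> (2 * i1 <= i3)%N.
Proof.
move=> /andP[i12 i23]; elim: w => [//|k w IHw] /=.
have rs := run_start_ge v01 k w; rewrite negb_or => h1 /andP[n2 w2].
have rs2 : (2 * (code_end w + k).+1 <= run_start v (k :: w))%N.
  by apply: leq_trans rs; rewrite leq_mul2r orbT.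
move=> /orP[/andP[B3 E3]|w3].
  case/orP: h1 => [/andP[B1 E1]|/code_word_lt]; last by lia.
  by move: n2; rewrite /= (_ : (_ <= _ < _)%N = true) //; move: E3 => /=; lia.
have e3 := code_word_lt w3.
case/orP: h1 => [/andP[B1 E1]|w1]; last exact: IHw.
by lia.
Qed.

(** The cases are: bounded position, bounded distance to the last block start, bounded distance to
    the next one, and neither. They yield a tail of [block_word], a tail of a limit of code words,
    such a limit preceded by finitely many places, and an eventually constant word. *)
Lemma block_limit U (p : nat -> nat) (b : nat -> bool) : UltraFilter U ->
  (forall i, U [set j | block_word (p j + i)%N = b i]) ->
  exists2 l : R, upper_density b l &
    [\/ l = 0, l = 1 | exists x, v (prefix_code x r) @[r --> \oo] --> l].
Proof.
move=> UU pb; have FU : ProperFilter U by exact: ultra_proper.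
have [[c pc]|pinf] := ultra_nat p UU.
  exists 0; last by constructor 1.
  rewrite (_ : b = fun i => block_word (c + i)%N).
    exact/(proj1 (upper_density_shift _ c _))/upper_density_block_word.
  by apply/funext => i; have [j /= [<- <-]] := filter_ex (filterI (pb i) pc).
(* Window [j] begins in block [J j], at offset [o j] from its start and [e j] places before the next
   block. *)
pose J j := block_index (p j).
have Jinf : forall N, U [set j | (N <= J j)%N] := block_index_cvg FU pinf.
pose o j := (p j - block_start (J j))%N; pose e j := (block_start (J j).+1 - p j)%N.
have oE j : (block_start (J j) + o j)%N = p j.
  by rewrite subnKC //; have /andP[] := block_indexP (p j).
have eE j : (p j + e j)%N = block_start (J j).+1.
  by rewrite subnKC // ltnW //; have /andP[] := block_indexP (p j).
have word_o i j : (i < e j)%N -> block_word (p j + i)%N = code_word v (nth_code (J j)) (o j + i).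
  by move=> ie; rewrite -(oE j) -addnA block_wordE // addnA oE -eE ltn_add2l.
have gap j : (J j <= o j + e j)%N.
  by have := block_start_lt (J j); rewrite -eE -(oE j) /= => ?; lia.
have good l : l = 0 \/ (exists x, v (prefix_code x r) @[r --> \oo] --> l) ->
    [\/ l = 0, l = 1 | exists x, v (prefix_code x r) @[r --> \oo] --> l].
  by case=> ?; [constructor 1|constructor 3].
have [[c oc]|oinf] := ultra_nat o UU.
  have word_c i : U [set j | block_word (p j + i)%N = code_word v (nth_code (J j)) (c + i)].
    apply: filterS2 oc (Jinf (c + i).+1) => j /= oj cJ; rewrite word_o ?oj //.
    by have := gap j; lia.
  pose cw i := `[< U [set j | code_word v (nth_code (J j)) i] >].
  have cwP i : U [set j | code_word v (nth_code (J j)) i = cw i].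
    rewrite /cw; case: asboolP => [|nU]; first by apply: filterS => j /= ->.
    have [//|] := in_ultra_setVsetC [set j | code_word v (nth_code (J j)) i] UU.
    by apply: filterS => j /= /negP/negbTE.
  have [l ul gl] := code_limit UU cwP; exists l; last exact: good.
  rewrite (_ : b = fun i => cw (c + i)%N); first exact/(proj1 (upper_density_shift _ c _)).
  apply/funext => i.
  by have [j /= [[<- ->] ->]] := filter_ex (filterI (filterI (pb i) (word_c i)) (cwP (c + i)%N)).
have [[c ec]|einf] := ultra_nat e UU.
  have wc i : U [set j | code_word v (nth_code (J j).+1) i = b (c + i)%N].
    apply: filterS3 ec (pb (c + i)%N) (Jinf i) => j /= ej <- iJ.
    rewrite addnA -ej eE block_wordE //.
    by have := block_start_lt (J j).+1; lia.
  have [l ul gl] := code_limit UU wc; exists l; last exact: good.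
  exact/(proj2 (upper_density_shift _ c _)).
(* A pattern 1 0 1 in [b] would occur inside one block at offset [o j > i3], and [code_word_gap]
   would give [2 * (o j + i1) <= o j + i3]. *)
have no101 i1 i2 i3 : (i1 < i2 < i3)%N -> b i1 -> b i3 -> b i2.
  move=> i123 b1 b3; apply/negPn/negP => b2.
  have [j /= [[ej oj] [[]]]] := filter_ex (filterI (filterI (einf i3.+1) (oinf i3.+1))
    (filterI (filterI (pb i1) (pb i2)) (pb i3))).
  move/andP: (i123) => [i12 i23]; rewrite !word_o; [|lia|lia|lia].
  move=> w1 w2 w3; rewrite -w1 in b1; rewrite -w2 in b2; rewrite -w3 in b3.
  have := @code_word_gap _ (o j + i1)%N (o j + i2)%N (o j + i3)%N _ b1 b2 b3.
  by rewrite !ltn_add2l i123 => /(_ isT); lia.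
have [[N bN]|/forallNP binf] := pselect (exists N, forall i, (N <= i)%N -> b i = false).
  by exists 0; [exact: (@upper_density_ev_const _ _ false N)|constructor 1].
exists 1; last by constructor 2.
have b_often N : exists2 i, (N <= i)%N & b i.
  have /existsNP[i /not_implyP[Ni bi]] := binf N; exists i => //.
  by apply/negPn/negP => /negbTE.
have [i0 _ bi0] := b_often 0%N.
apply: (@upper_density_ev_const _ _ true i0) => i; rewrite leq_eqVlt => /orP[/eqP<-//|ii0].
have [i3 ii3 bi3] := b_often i.+1; apply: (@no101 i0 _ i3) => //.
by rewrite ii0.
Qed.

Lemma block_realize x : exists p : nat -> nat,
  forall i, \forall r \near \oo, block_word (p r + i)%N = inf_word v x i.
Proof.
(* Windows placed at the starts of the blocks that code the prefixes of [x]. *)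
exists (fun r => block_start (pickle (prefix_code x r))) => i; near=> r.
have cE : nth_code (pickle (prefix_code x r)) = prefix_code x r by rewrite /nth_code pickleK.
have ir : (i < code_end (prefix_code x r))%N.
  by apply: leq_trans (code_end_prefix x r); near: r; exact: nbhs_infty_gt.
rewrite block_wordE; first by rewrite cE -inf_wordE_end.
by have := block_start_lt (pickle (prefix_code x r)); rewrite cE; lia.
Unshelve. all: by end_near. Qed.

End Blocks.

(** * Codes for an analytic set *)

Lemma half_pow_lt (R : realType) (e : R) : 0 < e -> \forall n \near \oo, 2^-1 ^+ n < e.
Proof.
move=> e0; have : (fun n : nat => 2^-1 ^+ n : R) @ \oo --> (0 : R).
  by apply: cvg_expr; rewrite ger0_norm // invf_lt1 // ltr1n.
move=> /cvgrPdist_lt /(_ e e0); apply: filterS => n.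
by rewrite sub0r normrN ger0_norm.
Qed.

(* A symbol k moves to the k-th point of a dense sequence if the step has size at
   most 2^-n at time n, and is ignored otherwise: every infinite code converges. *)
Lemma analytic_scheme (R : realType) (A : set R) : A !=set0 -> analytic A ->
  exists a : seq nat -> R,
    [/\ forall w, A (a w),
        forall x, exists2 l, A l & a (prefix_code x r) @[r --> \oo] --> l &
        forall l, A l -> exists x, a (prefix_code x r) @[r --> \oo] --> l].
Proof.
move=> [_ /[swap] -[T [f [Tc [D Dc Dd] fc <-]]] [t0 _ _]].
have D0 : D !=set0.
  by have [x [_ Dx]] := Dd setT (ex_intro _ t0 I) openT; exists x.
have [q qD] : exists q : nat -> T, forall t, D t -> exists k, q k = t.
  move: Dc => /pfcard_geP[D0'|[q]]; first by move: D0; rewrite D0' => -[].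
  by exists q => t Dt; have [k _ <-] := 'surj_q Dt; exists k.
have qd (t : T) (e : R) : 0 < e -> exists k, mdist t (q k) < e.
  move=> e0; have [x [tx Dx]] := Dd (ball t e)^°
    (ex_intro _ t (nbhsx_ballx t e e0)) (@open_interior _ _).
  have [k kx] := qD _ Dx; exists k; rewrite kx.
  by have := interior_subset tx; rewrite ballEmdist.
(* The first move is unconditional, so that a code may begin at any point of the dense sequence. *)
pose pt := fix pt w : T := if w is k :: w' then
  if (size w' == 0%N) || (mdist (pt w') (q k) <= 2^-1 ^+ size w') then q k else pt w'
  else q 0%N.
have pt_step k w : (0 < size w)%N -> mdist (pt w) (pt (k :: w)) <= 2^-1 ^+ size w.
  rewrite lt0n /= => /negbTE -> /=; case: ifP => // _.
  by rewrite mdistxx exprn_ge0.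
have pt_next k w : mdist (pt w) (q k) <= 2^-1 ^+ size w -> pt (k :: w) = q k.
  by move=> /= ->; rewrite orbT.
exists (f \o pt); split=> [w|x|_ [t _ <-]]; first by exists (pt w).
- pose y r := pt (prefix_code x r).
  (* The exact geometric sum of the step bounds; keeping the subtracted term lets the induction
     close. *)
  have ystep r m : (0 < r)%N -> mdist (y r) (y (m + r)%N) <= 2 * 2^-1 ^+ r - 2^-1 ^+ (m + r)%N * 2.
    move=> r0; elim: m => [|m IHm]; first by rewrite add0n mdistxx mulrC subrr.
    apply: le_trans (metric_triangle _ (y (m + r)%N) _) _.
    have := pt_step (x (m + r)%N) (prefix_code x (m + r)).
    rewrite size_prefix_code => /(_ (ltn_addl _ r0)) h.
    rewrite addSn exprS; rewrite /y /= in IHm h *.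
    by move: IHm h; set z := 2^-1 ^+ (m + r); lra.
  have yF : cauchy (y @ \oo).
    apply: cauchy_exP => e e0.
    have e20 : 0 < e / 2 by rewrite divr_gt0.
    near \oo => r; exists (y r); exists r => // n /= rn.
    rewrite ballEmdist /= -(subnK rn); apply: le_lt_trans (ystep _ _ _) _.
      by near: r; exact: nbhs_infty_gt.
    have : 2^-1 ^+ r < e / 2 by near: r; exact: half_pow_lt.
    have : 0 <= 2^-1 ^+ (n - r + r) :> R by rewrite exprn_ge0.
    by lra.
  have [l yl] := Tc _ _ yF; exists (f l); first by exists l.
  exact: (continuous_cvg _ (fc l) yl).
(* With q (x r) within 2^-(r+2) of [t], consecutive points are within 2^-(r+2) + 2^-(r+3) <
   2^-(r+1), so no move is ever refused. *)
- have [x xP] := choice (fun r => qd t (2^-1 ^+ r.+2) (exprn_gt0 _ (ltac:(by []) : 0 < 2^-1 :> R))).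
  have ptE r : pt (prefix_code x r.+1) = q (x r).
    elim: r => [//|r IHr]; apply: (@pt_next _ (prefix_code x r.+1)); rewrite IHr size_prefix_code.
    apply: le_trans (metric_triangle _ t _) _; rewrite metric_sym.
    have := xP r; have := xP r.+1; rewrite !exprS.
    have : 0 <= 2^-1 ^+ r :> R by rewrite exprn_ge0.
    by lra.
  exists x; apply: (continuous_cvg _ (fc t)).
  have ptE' r : (0 < r)%N -> pt (prefix_code x r) = q (x r.-1) by case: r => // r _; exact: ptE.
  apply/metricType_numDomainType.cvgrPdist_lt => e e0.
  near=> r; have r0 : (0 < r)%N by near: r; exact: nbhs_infty_gt.
  rewrite /= ptE' //; apply: lt_trans (xP _) _; rewrite prednK //.
  have : 2^-1 ^+ r < e by near: r; exact: half_pow_lt.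
  have : 0 <= 2^-1 ^+ r :> R by rewrite exprn_ge0.
  by rewrite exprS; lra.
Unshelve. all: by end_near. Qed.

(** * The digit set *)

Fixpoint bin_value (e : nat -> bool) (n : nat) : nat :=
  if n is n'.+1 then ((bin_value e n').*2 + e n')%N else 0%N.
Arguments bin_value e n%_N.

Lemma bin_valueD e n k :
  bin_value e (n + k)%N = (bin_value e n * 2 ^ k + bin_value (fun i => e (n + i)%N) k)%N.
Proof.
elim: k => [|k IHk]; first by rewrite addn0 muln1 addn0.
by rewrite addnS /= IHk expnS; lia.
Qed.

Lemma bin_value_lt e n : (bin_value e n < 2 ^ n)%N.
Proof. by elim: n => //= n IHn; rewrite expnS; case: (e n); lia. Qed.

Lemma eq_bin_value e e' n : (forall i, (i < n)%N -> e i = e' i) ->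
  bin_value e n = bin_value e' n.
Proof.
elim: n => //= n IHn ee'; rewrite ee' // IHn // => i ilt.
by apply: ee'; exact: leqW.
Qed.

Lemma bin_value_inj e e' n : bin_value e n = bin_value e' n ->
  forall i, (i < n)%N -> e i = e' i.
Proof.
elim: n => //= n IHn h i; rewrite ltnS leq_eqVlt => /orP[/eqP->|].
  by case: (e n) h; case: (e' n); lia.
by apply: IHn; case: (e n) h; case: (e' n); lia.
Qed.

Lemma card_count_below (b : nat -> bool) n : #|[set i : 'I_n | b i]%SET| = count_below b n.
Proof.
rewrite -sum1_card /count_below big_mkcond /=.
by apply: eq_bigr => i _; rewrite inE; case: (b i).
Qed.

(** * Comparison of the Euclidean distance with the coordinatewise one *)

Section L2.
Context (R : realType) (d : nat).
Implicit Types x y : 'rV[R]_d.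

Lemma l2distC x y : l2dist x y = l2dist y x.
Proof. by congr Num.sqrt; apply: eq_bigr => i _; rewrite -sqrrN opprB. Qed.

Lemma l2dist_ge0 x y : 0 <= l2dist x y.
Proof. exact: sqrtr_ge0. Qed.

Lemma coord_le_l2dist x y i : `|x ord0 i - y ord0 i| <= l2dist x y.
Proof.
rewrite -sqrtr_sqr ler_wsqrtr // (bigD1 i) //= lerDl.
by apply: sumr_ge0 => j _; exact: sqr_ge0.
Qed.

Lemma l2dist_le x y (e : R) : 0 <= e -> (forall i, `|x ord0 i - y ord0 i| <= e) ->
  l2dist x y <= d%:R * e.
Proof.
move=> e0 xye; have de : 0 <= d%:R * e by rewrite mulr_ge0.
rewrite -(ler_sqr (l2dist_ge0 _ _) de) /l2dist sqr_sqrtr; last first.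
  by apply: sumr_ge0 => i _; exact: sqr_ge0.
apply: (@le_trans _ _ (\sum_(i < d) e ^+ 2)).
  by apply: ler_sum => i _; rewrite -real_normK ?num_real // ler_sqr ?nnegrE.
rewrite sumr_const card_ord exprMn -[leLHS]mulr_natl ler_wpM2r ?sqr_ge0 //.
by rewrite -natrX ler_nat; case: d => // k; rewrite leq_pmulr.
Qed.

End L2.

Lemma rV_norm_le (R : realType) (d : nat) (x : 'rV[R]_d) (M : R) : 0 <= M ->
  (forall i, `|x ord0 i| <= M) -> `|x| <= M.
Proof.
move=> M0 xM; rewrite [leLHS]/Num.norm /= mx_normrE; apply/bigmax_leP; split => //.
by move=> [i j] _ /=; rewrite (ord1 i).
Qed.

Lemma rV_coord_le_norm (R : realType) (d : nat) (x : 'rV[R]_d) i : `|x ord0 i| <= `|x|.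
Proof.
rewrite [leRHS]/Num.norm /= mx_normrE; apply/bigmax_geP; right => /=.
by exists (ord0, i).
Qed.

(** * Points of the cube with binary digits supported on [D] *)

Section DigitSet.
Context (R : realType) (d : nat) (D : nat -> bool).
Implicit Types (e : 'I_d -> nat -> bool) (x y z u : 'rV[R]_d).

Definition dyadic_point e (n : nat) : 'rV[R]_d :=
  \row_i ((bin_value (e i) n)%:R * 2^-1 ^+ n).
Arguments dyadic_point e n%_N.

Definition admissible e : Prop := forall i n, e i n -> D n.

(** Taking the closure of the finite expansions avoids infinite series and makes the set closed by
    construction. *)
Definition digit_set : set 'rV[R]_d :=
  closure [set dyadic_point en.1 en.2 | en in [set en | admissible en.1]].

Definition window (lam : R) u : set 'rV[R]_d :=
  [set lam *: z + u | z in digit_set] `&` @unit_cube R d.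

Lemma half_powK n : 2 ^+ n * 2^-1 ^+ n = 1 :> R.
Proof. by rewrite -exprMn divff // expr1n. Qed.

Lemma dyadic_pointE e n i : dyadic_point e n ord0 i = (bin_value (e i) n)%:R * 2^-1 ^+ n.
Proof. by rewrite mxE. Qed.

Lemma dyadic_point_cell e n k i :
  dyadic_point e n ord0 i <= dyadic_point e (n + k) ord0 i <= dyadic_point e n ord0 i + 2^-1 ^+ n.
Proof.
rewrite !dyadic_pointE bin_valueD natrD natrM natrX mulrDl exprD.
have E : (bin_value (e i) n)%:R * 2 ^+ k * (2^-1 ^+ n * 2^-1 ^+ k) =
    (bin_value (e i) n)%:R * 2^-1 ^+ n :> R.
  by rewrite mulrACA half_powK mulr1.
rewrite E lerDl lerD2l; set s := (bin_value _ k)%:R.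
have s0 : 0 <= s by exact: ler0n.
have sk : s <= 2 ^+ k by rewrite -natrX ler_nat ltnW // bin_value_lt.
rewrite mulr_ge0 ?mulr_ge0 ?exprn_ge0 //=.
rewrite mulrCA ler_piMr ?exprn_ge0 //.
apply: (@le_trans _ _ (2 ^+ k * 2^-1 ^+ k)); last by rewrite half_powK.
by rewrite ler_wpM2r // exprn_ge0.
Qed.

Lemma dyadic_point01 e n i : 0 <= dyadic_point e n ord0 i <= 1.
Proof. by have := dyadic_point_cell e 0 n i; rewrite !dyadic_pointE /= mul0r add0r. Qed.

Lemma eq_dyadic_point e e' n i : (forall k, (k < n)%N -> e i k = e' i k) ->
  dyadic_point e n ord0 i = dyadic_point e' n ord0 i.
Proof. by move=> h; rewrite !dyadic_pointE (eq_bin_value h). Qed.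

Lemma digit_set_dyadic e n : admissible e -> digit_set (dyadic_point e n).
Proof. by move=> he; apply: subset_closure; exists (e, n). Qed.

Lemma digit_set_approx z (delta : R) (M : nat) : digit_set z -> 0 < delta ->
  exists e n, [/\ admissible e, (M <= n)%N &
    forall i, `|z ord0 i - dyadic_point e n ord0 i| < delta].
Proof.
move=> Kz delta0; have [_ [[[e n] /= he <-] zy]] := Kz _ (nbhsx_ballx z delta delta0).
(* Cutting the digits off at [n] and padding with [M] zeros makes the expansion long without moving
   the point. *)
pose e' i k := e i k && (k < n)%N.
exists e', (n + M)%N; split; first by move=> i k /andP[/he].
  exact: leq_addl.
move=> i; suff -> : dyadic_point e' (n + M) ord0 i = dyadic_point e n ord0 i by case: zy => _ /(_ ord0 i).
rewrite !dyadic_pointE bin_valueD (@eq_bin_value _ (e i)); last first.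
  by move=> k kn; rewrite /e' kn andbT.
rewrite (@eq_bin_value _ (fun=> false) M); last first.
  by move=> k _; rewrite /e' ltnNge leq_addr andbF.
have -> : bin_value (fun=> false) M = 0%N by elim: (M) => //= k ->.
by rewrite addn0 natrM natrX exprD mulrACA half_powK mulr1.
Qed.

Lemma digit_set01 z i : digit_set z -> 0 <= z ord0 i <= 1.
Proof.
move=> Kz; apply/andP; split; apply/ler_addgt0Pl => /= dl dl0;
  have [e [n [_ _ /(_ i)]]] := digit_set_approx 0 Kz dl0; rewrite ltr_norml;
  have := dyadic_point01 e n i; lra.
Qed.

Lemma compact_digit_set : compact digit_set.
Proof.
apply: bounded_closed_compact; last exact: closed_closure.
exists 1; split; first exact: num_real.
move=> M M1 z Kz /=; apply: rV_norm_le => [|i]; first lra.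
by rewrite ler_norml; have := digit_set01 i Kz; lra.
Qed.

Lemma digit_set0 : digit_set 0.
Proof.
rewrite (_ : 0 = dyadic_point (fun _ _ => false) 0); first exact: digit_set_dyadic.
by apply/rowP => i; rewrite !mxE mul0r.
Qed.

End DigitSet.

(** * Covering numbers of windows *)

Section Covering.
Context (R : realType) (d : nat).
Implicit Types (X : set 'rV[R]_d) (x y : 'rV[R]_d).

(** One ball per label, centred at a point of [X] carrying that label; labels that do not occur get
    the dummy centre [x0]. *)
Lemma covering_number_le X n (I : finType) (L : {set I}) (g : 'rV[R]_d -> I) : X !=set0 ->
  (forall x, X x -> g x \in L) ->
  (forall x y, X x -> X y -> g x = g y -> l2dist x y <= 2^-1 ^+ n) ->
  (covering_number X n <= (#|L|%:R : R)%:E)%E.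
Proof.
move=> [x0 Xx0] gL gX; apply: ereal_inf_lbound; exists #|L| => //=.
have /choice[c hc] : forall i : 'I_#|L|, exists x, X x /\
    ((exists2 y, X y & g y = enum_val i) -> g x = enum_val i).
  move=> i; have [[y Xy gy]|no] := pselect (exists2 y, X y & g y = enum_val i).
    by exists y.
  by exists x0; split => // /no.
exists c, (fun=> 2^-1 ^+ n); split => [i|x Xx].
  by split; [have [] := hc i|rewrite exprn_gt0 //= exprVn].
have gx := gL _ Xx; exists (enum_rank_in gx (g x)).
have [Xc gc] := hc (enum_rank_in gx (g x)).
apply: gX => //; rewrite gc ?enum_rankK_in //.
by exists x => //; rewrite enum_rankK_in.
Qed.

(** Two points sharing a ball of radius at most 2^-n differ by at most twice that in each
    coordinate, so distinct points [h f] need distinct balls. *)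
Lemma covering_number_ge X n (I : finType) (L : {set I}) (h : I -> 'rV[R]_d) :
  (forall f, f \in L -> X (h f)) ->
  (forall f f', f \in L -> f' \in L -> f != f' ->
     exists i, 2 * 2^-1 ^+ n < `|h f ord0 i - h f' ord0 i|) ->
  ((#|L|%:R : R)%:E <= covering_number X n)%E.
Proof.
move=> hX hsep; apply: le_ereal_inf_tmp => _ [k [c [r [cr cov]]] <-].
rewrite lee_fin ler_nat; case: k c r cr cov => [|k] c r cr cov.
  rewrite leqn0 cards_eq0; apply/eqP/setP => f; rewrite inE; apply/negbTE/negP => fL.
  by have [[]] := cov _ (hX _ fL).
have /choice[idx hidx] : forall f, exists i, f \in L -> l2dist (c i) (h f) <= r i.
  move=> f; have [fL|nf] := boolP (f \in L); last by exists ord0.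
  by have [i hi] := cov _ (hX _ fL); exists i.
rewrite -[leqRHS]card_ord; apply: (@leq_card_in _ _ idx) => f f' fL f'L ff'.
apply/eqP/negPn/negP => /(hsep _ _ fL f'L)[i]; apply/negP; rewrite -leNgt.
have := le_trans (coord_le_l2dist _ _ i) (hidx _ fL).
have := le_trans (coord_le_l2dist _ _ i) (hidx _ f'L).
have [_ /andP[_]] := cr (idx f); rewrite -ff' -exprVn => rn h1 h2.
apply: le_trans (ler_distD (c (idx f) ord0 i) _ _) _.
by rewrite (distrC (h f ord0 i)); lra.
Qed.

Lemma window_approx (D : nat -> bool) (lam : R) (u x : 'rV[R]_d) (p M : nat) (eta : R) :
  2 ^+ p <= lam -> 0 < eta -> window D lam u x ->
  exists e n, [/\ admissible D e, (M <= n)%N &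
    forall i, `|x ord0 i - (lam * dyadic_point R e n ord0 i + u ord0 i)| <= eta].
Proof.
move=> plam eta0 [[z Kz <-] _].
have lam0 : 0 < lam by apply: lt_le_trans plam; rewrite exprn_gt0.
have [e [n [he Mn zy]]] := digit_set_approx M Kz (divr_gt0 eta0 lam0).
exists e, n; split => // i; rewrite !mxE opprD addrACA subrr addr0 -mulrBr normrM gtr0_norm //.
by rewrite mulrC -ler_pdivlMr // ltW // -[X in _ - X]dyadic_pointE.
Qed.

(* A point of the window is labelled by the position of its cell of generation p
   relative to the corner of the window (at most 5 possibilities per coordinate)
   and by its next N digits. *)
Lemma covering_number_window_le (D : nat -> bool) X (lam : R) (u : 'rV[R]_d) (p n c : nat) :
  (0 < d)%N -> X !=set0 -> 2 ^+ p <= lam -> lam <= 2 ^+ p.+1 -> 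
  8 * d%:R * 2^-1 ^+ c <= (1 : R) ->
  (forall x, X x -> exists2 y, window D lam u y & l2dist x y <= 2^-1 ^+ n / (4 * d%:R)) ->
  (covering_number X n <=
    (((5 * 2 ^ count_below (fun i => D (p + i)%N) (n + c)) ^ d)%N%:R : R)%:E)%E.
Proof.
move=> d0 X0 plam lamp hc close; set N := (n + c)%N.
have dR : (0 : R) < d%:R by rewrite ltr0n.
have lam0 : 0 < lam by apply: lt_le_trans plam; rewrite exprn_gt0.
have pow0 k : (0 : R) < 2^-1 ^+ k by exact: exprn_gt0.
(* The tolerance per coordinate: [d%:R * eta] is the target radius 2^-n. The [c] additional digits
   bring the side of a magnified cell below [eta / 4]. *)
set eta : R := 2^-1 ^+ n / d%:R.
have eta0 : 0 < eta by rewrite divr_gt0.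
have etaN : lam * 2^-1 ^+ (p + N) <= eta / 4.
  apply: (@le_trans _ _ (2 ^+ p.+1 * 2^-1 ^+ (p + N))); first by rewrite ler_wpM2r // ltW.
  rewrite exprS exprD -mulrA (mulrA (2 ^+ p)) half_powK mul1r exprD /eta.
  rewrite ler_pdivlMr // -(ler_pM2r dR) mulrAC divfK ?gt_eqF //.
  rewrite -(ler_pM2l (pow0 n)) in hc; move: hc; set z := 2^-1 ^+ n; set z' := 2^-1 ^+ c.
  by nra.
pose lab := (('I_5 * {set 'I_N})%type : finType).
pose TT := [set i : 'I_N | D (p + i)%N]%SET.
pose L := [set f : {ffun 'I_d -> lab} | [forall i, (f i).2 \subset TT]]%SET.
have cardL : #|L| = ((5 * 2 ^ count_below (fun i => D (p + i)%N) N) ^ d)%N.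
  pose S := [set a : lab | a.2 \subset TT]%SET.
  have -> : #|L| = #|(ffun_on (mem S) : pred {ffun 'I_d -> lab})|.
    apply: eq_card => f; rewrite !inE; apply: eq_forallb => i.
    by rewrite !inE.
  rewrite card_ffun_on card_ord; congr (_ ^ _)%N.
  have -> : S = finset.setX [set: 'I_5]%SET (powerset TT).
    by apply/setP => a; rewrite !inE.
  by rewrite cardsX cardsT card_ord card_powerset -(card_count_below (fun i => D (p + i)%N)).
rewrite -cardL.
have /choice[G hG] : forall x, exists G : ('I_d -> nat -> bool) * nat, X x ->
    [/\ admissible D G.1, (p + N <= G.2)%N & forall i,
      `|x ord0 i - (lam * dyadic_point R G.1 G.2 ord0 i + u ord0 i)| <= eta / 4 + eta / 8 /\
      - u ord0 i - eta / 8 <= lam * dyadic_point R G.1 G.2 ord0 i <= 1 - u ord0 i + eta / 8].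
  move=> x; have [Xx|] := pselect (X x); last by exists (fun _ _ => false, 0%N).
  have [y Wy xy] := close x Xx.
  have e80 : 0 < eta / 8 by rewrite divr_gt0.
  have [e [m [he pm yd]]] := window_approx (p + N) plam e80 Wy.
  exists (e, m) => _; split => // i; split.
    apply: le_trans (ler_distD (y ord0 i) _ _) _; rewrite lerD //.
    apply: le_trans (coord_le_l2dist _ _ _) _; apply: le_trans xy _.
    by rewrite /eta invfM mulrA mulrAC.
  have := yd i; have := Wy.2 i; rewrite ler_norml /=; lra.
(* The corner of the window pulled back to the digit set, in units of 2^-p. As [2 ^+ p <= lam], the
   pulled-back cube has side at most 1, so cell indices differ from [a i] by at most 9/8; adding 2
   lands in [0, 5), where [inord] is faithful. *)
pose a i := - u ord0 i / lam * 2 ^+ p.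
pose g x : {ffun 'I_d -> lab} := [ffun i =>
  (inord (Num.truncn ((bin_value ((G x).1 i) p)%:R - a i + 2)),
   [set t : 'I_N | (G x).1 i (p + t)%N]%SET)].
have trunc x i : X x ->
    0 <= (bin_value ((G x).1 i) p)%:R - a i + 2 < 5.
  move=> Xx; have [_ pG /(_ i)[_ /andP[h1 h2]]] := hG x Xx.
  have pG' : (p <= (G x).2)%N by apply: leq_trans pG; rewrite leq_addr.
  have := dyadic_point_cell R (G x).1 p ((G x).2 - p) i; rewrite subnKC //.
  have eta8 : eta <= 1.
    rewrite ler_pdivrMr // mul1r (le_trans (_ : _ <= 1)) ?ler1n //.
    by rewrite exprn_ile1 // ?invf_le1 ?ler1n.
  set Y := dyadic_point _ _ _ _ _ in h1 h2 *; rewrite dyadic_pointE.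
  set b := (bin_value _ p)%:R => /andP[c1 c2].
  have q0 : 0 < 2 ^+ p / lam by rewrite divr_gt0 // exprn_gt0.
  have q1 : 2 ^+ p / lam <= 1 by rewrite ler_pdivrMr // mul1r.
  have aE : a i = - u ord0 i * (2 ^+ p / lam) by rewrite /a mulrAC mulrA.
  have YE : Y * 2 ^+ p = lam * Y * (2 ^+ p / lam).
    by rewrite [RHS]mulrC mulrA divfK ?gt_eqF // mulrC.
  have bY : b <= Y * 2 ^+ p by rewrite -ler_pdivrMr ?exprn_gt0 // -exprVn.
  have Yb : Y * 2 ^+ p <= b + 1.
    by rewrite -ler_pdivlMr ?exprn_gt0 // -exprVn mulrDl mul1r.
  move: bY Yb q0 q1; rewrite aE YE; set q := 2 ^+ p / lam => bY Yb q0 q1.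
  have w1 := ler_wpM2r (ltW q0) h1; have w2 := ler_wpM2r (ltW q0) h2.
  have eq1 : eta * q <= 1 by rewrite mulr_ile1 // ltW.
  rewrite mulrDl mulNr in w1; rewrite !mulrDl mulNr mul1r in w2; rewrite mulNr.
  have e0 : 0 <= eta * q by rewrite mulr_ge0 // ltW.
  have eq8 : eta / 8 * q = eta * q / 8 by rewrite mulrAC.
  rewrite mulNr eq8 in w1; rewrite eq8 in w2.
  move: bY Yb w1 w2 eq1 e0 q1 q0; set A := lam * Y * q; set B := u ord0 i * q; set C := eta * q.
  clear; clearbody A B C b q => *; apply/andP; split; lra.
apply: (@covering_number_le _ _ _ L g) => // [x Xx|x y Xx Xy gxy].
  rewrite inE; apply/forallP => i; rewrite ffunE /=; apply/fintype.subsetP => t; rewrite !inE.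
  by have [he _ _] := hG x Xx; apply: he.
(* Each coordinate costs 3/8 of [eta] for either approximation and 1/4 for the common cell, [eta] in
   all. *)
apply: (@le_trans _ _ (d%:R * eta)); last by rewrite mulrC divfK ?gt_eqF.
apply: l2dist_le => [|i]; first exact: ltW.
have [_ pGx /(_ i)[hx _]] := hG x Xx; have [_ pGy /(_ i)[hy _]] := hG y Xy.
have := congr1 (fun f : {ffun 'I_d -> lab} => f i) gxy; rewrite !ffunE => -[ebin ebits].
have bE : bin_value ((G x).1 i) p = bin_value ((G y).1 i) p.
  have /andP[x0 x5] := trunc x i Xx; have /andP[y0 y5] := trunc y i Xy.
  have t5 r : 0 <= r < 5 -> (Num.truncn r < 5)%N by move=> /andP[r0 r5]; rewrite truncn_lt_nat.
  have := congr1 (@nat_of_ord 5) ebin; rewrite !inordK ?t5 ?x0 ?y0 //.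
  have /andP[l1 r1] := truncn_itv x0; have /andP[l2 r2] := truncn_itv y0 => trE.
  rewrite trE -natr1 in l1 r1; rewrite -natr1 in r2.
  (* Integers shifted by the same real and truncated to the same value differ by less than 1. *)
  apply/eqP; rewrite eqn_leq; apply/andP.
  by split; rewrite -ltnS -(ltr_nat R) -natr1; lra.
have cellE : dyadic_point R (G x).1 (p + N) ord0 i = dyadic_point R (G y).1 (p + N) ord0 i.
  apply: eq_dyadic_point => k kN; have [kp|pk] := ltnP k p; first exact: bin_value_inj bE _ kp.
  have kpN : (k - p < N)%N by rewrite ltn_subLR.
  have /setP/(_ (Ordinal kpN)) := ebits; rewrite !inE /= subnKC //.
have := dyadic_point_cell R (G x).1 (p + N) ((G x).2 - (p + N)) i.
have := dyadic_point_cell R (G y).1 (p + N) ((G y).2 - (p + N)) i.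
rewrite !subnKC // cellE; move: hx hy etaN.
set Yx := dyadic_point _ _ (G x).2 _ _; set Yy := dyadic_point _ _ (G y).2 _ _.
set Z := dyadic_point _ _ _ _ _; set h := 2^-1 ^+ _.
rewrite !ler_norml => /andP[x1 x2] /andP[y1 y2] lh /andP[z1 z2] /andP[z3 z4].
have l1 : lam * Yx <= lam * (Z + h) by rewrite ler_pM2l.
have l2 : lam * Yy <= lam * (Z + h) by rewrite ler_pM2l.
have l3 : lam * Z <= lam * Yx by rewrite ler_pM2l.
have l4 : lam * Z <= lam * Yy by rewrite ler_pM2l.
by rewrite mulrDr in l1 l2; apply/andP; split; lra.
Qed.

End Covering.

(** Freeze the first [p + m] digits at those of a point near [e], which confines everything to a
    small neighbourhood of [e], and let the next [N] digits vary freely in [D]. The resulting points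
    of the window are separated by 2^-(m+N) and can be moved into [E], then into [F], which is only
    assumed [eps]-dense in [E] near [e]. *)
Lemma covering_number_window_ge (R : realType) (d : nat) (D : nat -> bool)
    (E F : set 'rV[R]_d) (lam : R) (u e : 'rV[R]_d) (p m N : nat) (r eps : R) :
  2 ^+ p <= lam -> lam <= 2 ^+ p.+1 -> 2 * 2^-1 ^+ m <= r / 4 ->
  0 < eps -> eps <= r / 8 -> eps <= 2^-1 ^+ (m + N) / 16 ->
  (forall x : 'rV[R]_d, (forall i, `|x ord0 i - e ord0 i| < r) -> @unit_cube R d x) ->
  (exists2 y, window D lam u y & l2dist y e <= eps) ->
  (forall y, window D lam u y -> exists2 e', E e' & l2dist y e' <= eps) ->
  (forall e' : 'rV[R]_d, E e' -> (forall i, `|e' ord0 i - e ord0 i| < r) ->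
     exists2 f, F f & forall i, `|f ord0 i - e' ord0 i| <= eps) ->
  ((((2 ^ count_below (fun i => D (p + m + i)%N) N) ^ d)%N%:R : R)%:E <=
     covering_number F (m + N + 2))%E.
Proof.
move=> plam lamp mr eps0 epsr epsN cube [x Wx xe] WE EF.
have r0 : 0 < r by lra.
have lam0 : 0 < lam by apply: lt_le_trans plam; rewrite exprn_gt0.
have r80 : 0 < r / 8 by rewrite divr_gt0.
have [g [M [hg pmM xg]]] := window_approx (p + m) plam r80 Wx.
pose TT := [set i : 'I_N | D (p + m + i)%N]%SET.
pose L := [set f : {ffun 'I_d -> {set 'I_N}} | [forall i, f i \subset TT]]%SET.
have cardL : #|L| = ((2 ^ count_below (fun i => D (p + m + i)%N) N) ^ d)%N.
  have -> : #|L| = #|(ffun_on (mem (powerset TT)) : pred {ffun 'I_d -> {set 'I_N}})|.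
    by apply: eq_card => f; rewrite !inE; apply: eq_forallb => i; rewrite !inE.
  by rewrite card_ffun_on card_ord card_powerset -(card_count_below (fun i => D (p + m + i)%N)).
rewrite -cardL.
pose dig (f : {ffun 'I_d -> {set 'I_N}}) (i : 'I_d) (k : nat) : bool :=
  if (k < p + m)%N then g i k else
  if insub (k - (p + m))%N is Some t then t \in f i else false.
have digE f i (t : 'I_N) : dig f i (p + m + t)%N = (t \in f i).
  by rewrite /dig ltnNge leq_addr /= addKn (valK t).
have dig_adm f : f \in L -> admissible D (dig f).
  rewrite inE => /forallP fT i k; rewrite /dig; case: ifPn => [_|]; first exact: hg.
  rewrite -leqNgt => pk; case: insubP => //= t _ tE /(fintype.subsetP (fT i)).
  by rewrite inE tE subnKC.
pose pt f : 'rV[R]_d := lam *: dyadic_point R (dig f) (p + m + N) + u.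
have ptE f i : pt f ord0 i = lam * dyadic_point R (dig f) (p + m + N) ord0 i + u ord0 i.
  by rewrite !mxE.
have lm : lam * 2^-1 ^+ (p + m) <= r / 4.
  apply: le_trans mr; apply: (@le_trans _ _ (2 ^+ p.+1 * 2^-1 ^+ (p + m))).
    by rewrite ler_wpM2r // exprn_ge0.
  by rewrite exprS exprD -mulrA (mulrA (2 ^+ p)) half_powK mul1r.
have pt_near f i : `|pt f ord0 i - e ord0 i| < r / 2 + r / 16.
  rewrite ptE; have cellE : dyadic_point R (dig f) (p + m) ord0 i = dyadic_point R g (p + m) ord0 i.
    by apply: eq_dyadic_point => k kpm; rewrite /dig kpm.
  have := dyadic_point_cell R (dig f) (p + m) N i.
  have := dyadic_point_cell R g (p + m) (M - (p + m)) i; rewrite subnKC // cellE.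
  have := xg i; have := le_trans (coord_le_l2dist _ _ i) xe; move: lm.
  set Yg := dyadic_point _ _ M _ _; set Yf := dyadic_point _ (dig f) _ _ _.
  set Z := dyadic_point _ _ _ _ _; set h := 2^-1 ^+ _ => lh.
  rewrite !ler_norml => /andP[x1 x2] /andP[y1 y2] /andP[z1 z2] /andP[z3 z4].
  have l1 : lam * Yg <= lam * (Z + h) by rewrite ler_pM2l.
  have l2 : lam * Yf <= lam * (Z + h) by rewrite ler_pM2l.
  have l3 : lam * Z <= lam * Yg by rewrite ler_pM2l.
  have l4 : lam * Z <= lam * Yf by rewrite ler_pM2l.
  by rewrite mulrDr in l1 l2; rewrite ltr_norml; apply/andP; split; lra.
have pt_W f : f \in L -> window D lam u (pt f).
  move=> fL; split; last by apply: cube => i; apply: lt_trans (pt_near f i) _; lra.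
  exists (dyadic_point R (dig f) (p + m + N)) => //.
  exact/digit_set_dyadic/dig_adm.
have /choice[h hh] : forall f : {ffun 'I_d -> {set 'I_N}}, exists h : 'rV[R]_d, f \in L ->
    F h /\ forall i, `|h ord0 i - pt f ord0 i| <= 2 * eps.
  move=> f; have [fL|_] := boolP (f \in L); last by exists 0.
  have [e' Ee' pe'] := WE _ (pt_W _ fL).
  have pe i := le_trans (coord_le_l2dist _ _ i) pe'.
  have [i|h Fh he] := EF _ Ee'.
    apply: le_lt_trans (ler_distD (pt f ord0 i) _ _) _; rewrite distrC.
    by have := pe i; have := pt_near f i; lra.
  exists h => _; split=> // i; apply: le_trans (ler_distD (e' ord0 i) _ _) _.
  by rewrite (distrC (e' ord0 i)); have := pe i; have := he i; lra.
apply: (@covering_number_ge _ _ _ _ _ L h) => [f /hh[]//|f f' fL f'L ff'].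
have [i fi] : exists i, f i != f' i.
  apply/existsP; rewrite -negb_forall; apply: contra ff' => /forallP ff'.
  by apply/eqP/ffunP => i; apply/eqP.
exists i; have [_ /(_ i) hf] := hh f fL; have [_ /(_ i) hf'] := hh f' f'L.
have neq : bin_value (dig f i) (p + m + N) != bin_value (dig f' i) (p + m + N).
  apply: contra fi => /eqP /bin_value_inj bE; apply/eqP/setP => t.
  have := bE (p + m + t)%N; rewrite ltn_add2l ltn_ord => /(_ isT).
  by rewrite !digE.
have sep : 2^-1 ^+ (m + N) <= `|pt f ord0 i - pt f' ord0 i|.
  rewrite !ptE opprD addrACA subrr addr0 -mulrBr normrM gtr0_norm //.
  rewrite !dyadic_pointE -mulrBl normrM (ger0_norm (exprn_ge0 _ _)) //.
  set k := `|_ - _|; have k1 : 1 <= k.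
    rewrite /k; move: neq; rewrite neq_ltn => /orP[] kk.
      rewrite distrC ler_normr; apply/orP; left; rewrite lerBrDr addrC natr1 ler_nat //.
    by rewrite ler_normr; apply/orP; left; rewrite lerBrDr addrC natr1 ler_nat.
  rewrite mulrCA; apply: (@le_trans _ _ (lam * 2^-1 ^+ (p + m + N))); last first.
    by rewrite ler_peMl // mulr_ge0 ?exprn_ge0 // ltW.
  rewrite -addnA (exprD _ p) mulrA ler_peMl ?exprn_ge0 //.
  apply: (@le_trans _ _ (2 ^+ p * 2^-1 ^+ p)); first by rewrite half_powK.
  by rewrite ler_wpM2r ?exprn_ge0.
rewrite exprD; set z := 2^-1 ^+ (m + N) in epsN sep *.
(* Each of the two points has moved by at most [2 * eps], so a gap of at least z - z/4 remains, more
   than the required z/2. *)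
have -> : 2 * (z * 2^-1 ^+ 2) = z / 2 by rewrite expr2; field.
have z0 : 0 < z by rewrite exprn_gt0.
move: hf hf' sep; rewrite ler_normr !ler_norml ltr_normr => /andP[a1 a2] /andP[b1 b2] /orP[c|c].
  by apply/orP; left; lra.
by apply/orP; right; lra.
Qed.

(** * Digit densities and box dimension *)

Section Rates.
Context (R : realType) (alpha beta : R) (b : nat -> bool).
Hypotheses (alpha0 : 0 <= alpha) (alpha_beta : alpha <= beta) (beta1 : beta <= 1).

Definition rate_sum (n : nat) : R := alpha * n%:R + (beta - alpha) * (count_below b n)%:R.

(** A Beatty-type set: a position is taken when the integer part of the accumulated rate jumps, the
    rate being [alpha] where [b] is 0 and [beta] where it is 1. *)
Definition rate_set (n : nat) : bool :=
  (Num.truncn (rate_sum n) < Num.truncn (rate_sum n.+1))%N.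

Lemma rate_sumS n : rate_sum n <= rate_sum n.+1 <= rate_sum n + 1.
Proof.
rewrite /rate_sum count_belowS -natr1 natrD !mulrDr mulr1.
have x0 : 0 <= (beta - alpha) * (b n)%:R by rewrite mulr_ge0 ?subr_ge0.
have x1 : (beta - alpha) * (b n)%:R <= beta - alpha.
  by rewrite ler_piMr ?subr_ge0 // lern1 leq_b1.
move: alpha0 beta1 x0 x1; set x := _ * (b n)%:R; set y := alpha * _; set z := _ * (count_below b n)%:R.
by clearbody x y z => *; apply/andP; split; lra.
Qed.

Lemma rate_sum_ge0 n : 0 <= rate_sum n.
Proof. by rewrite addr_ge0 // mulr_ge0 // subr_ge0. Qed.

Lemma count_below_rate_set n : count_below rate_set n = Num.truncn (rate_sum n).
Proof.
elim: n => [|n IHn].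
  by rewrite count_below0 /rate_sum count_below0 !mulr0 addr0 truncn0.
rewrite count_belowS IHn /rate_set; have /andP[s1 s2] := rate_sumS n.
have /andP[l1 r1] := truncn_itv (rate_sum_ge0 n).
have /andP[l2 r2] := truncn_itv (rate_sum_ge0 n.+1).
have le1 : (Num.truncn (rate_sum n) <= Num.truncn (rate_sum n.+1))%N.
  by apply: le_truncn.
have le2 : (Num.truncn (rate_sum n.+1) < (Num.truncn (rate_sum n)).+2)%N.
  by rewrite -(ltr_nat R) -natr1; lra.
by case: ltnP => /=; lia.
Qed.

(** The error comes from the integer parts at the two ends. It is uniform in [p], hence survives the
    passage to limits of shifts. *)
Lemma count_rate_window p n :
  `|(count_below (fun i => rate_set (p + i)%N) n)%:R -
    (alpha * n%:R + (beta - alpha) * (count_below (fun i => b (p + i)%N) n)%:R)| <= 1.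
Proof.
have := count_belowD rate_set p n; rewrite !count_below_rate_set => /(congr1 (fun k => k%:R : R)).
rewrite natrD; have sE : rate_sum (p + n)%N = rate_sum p +
    (alpha * n%:R + (beta - alpha) * (count_below (fun i => b (p + i)%N) n)%:R).
  by rewrite /rate_sum count_belowD !natrD; ring.
have /andP[l1 r1] := truncn_itv (rate_sum_ge0 p).
have /andP[l2 r2] := truncn_itv (rate_sum_ge0 (p + n)).
rewrite sE in l2 r2 *; rewrite -natr1 in r1; rewrite -natr1 in r2.
by rewrite ler_norml => ?; apply/andP; split; lra.
Qed.

End Rates.

(** * Criteria for the upper box dimension, and a Baire category argument *)

Section BoxDimension.
Context (R : realType) (d : nat).
Implicit Types X : set 'rV[R]_d.

Lemma covering_number_ge0 X n : (0 <= covering_number X n)%E.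
Proof. by apply: le_ereal_inf_tmp => _ [k _ <-]; rewrite lee_fin. Qed.

Lemma ln2_gt0 : 0 < ln 2 :> R.
Proof. by rewrite ln_gt0 // ltr1n. Qed.

Lemma lne_nat (M : nat) : (0 < M)%N -> lne (M%:R : R)%:E = (ln (M%:R : R))%:E.
Proof. by move=> M0; rewrite lne_EFin // ltr0n. Qed.

Lemma upper_box_dim_le X (v : R) :
  (forall e : R, 0 < e -> \forall n \near \oo, exists M : nat, [/\ (0 < M)%N,
     (covering_number X n <= (M%:R : R)%:E)%E & ln (M%:R : R) <= (v + e) * (n%:R * ln 2)]) ->
  (upper_box_dim X <= v%:E)%E.
Proof.
move=> h; apply/lee_addgt0Pr => e e0; rewrite -EFinD.
have [N _ hN] := h e e0; apply: ge_ereal_inf.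
(* Starting at [N.+1] keeps the denominator positive. *)
exists (ereal_sup ((fun n : nat =>
    (lne (covering_number X n) / ((n%:R * ln 2)%R%:E))%E) @` [set n | (N.+1 <= n)%N])).
  by exists [set n | (N.+1 <= n)%N] => //; exact: nbhs_infty_ge.
apply: ge_ereal_sup => _ [n /= Nn <-].
have [M [M0 cM lM]] := hN n (ltnW Nn).
have n0 : 0 < n%:R * ln 2 :> R by rewrite mulr_gt0 ?ln2_gt0 // ltr0n; lia.
rewrite inver gt_eqF // lee_pdivrMr // -EFinM.
apply: le_trans (_ : ((ln M%:R)%:E <= _)%E); last by rewrite lee_fin.
rewrite -lne_nat // lee_lne // ?in_itv /= ?leey ?andbT ?covering_number_ge0 //.
Qed.

Lemma upper_box_dim_ge X (v : R) :
  (forall (e : R) (N : nat), 0 < e -> exists n M : nat, [/\ (N <= n)%N, (0 < M)%N,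
     ((M%:R : R)%:E <= covering_number X n)%E & (v - e) * (n%:R * ln 2) <= ln (M%:R : R)]) ->
  (v%:E <= upper_box_dim X)%E.
Proof.
move=> h; apply: le_ereal_inf_tmp => _ [V [N _ NV] <-].
apply/lee_addgt0Pr => e e0; rewrite -leeBlDr // -EFinB.
have [n [M [Nn M0 cM lM]]] := h e N.+1 e0.
apply: ereal_sup_ge; exists (lne (covering_number X n) / ((n%:R * ln 2)%R%:E))%E.
  by exists n => //; apply: NV => /=; lia.
have n0 : 0 < n%:R * ln 2 :> R by rewrite mulr_gt0 ?ln2_gt0 // ltr0n; lia.
rewrite inver gt_eqF // lee_pdivlMr // -EFinM.
apply: (@le_trans _ _ (ln M%:R)%:E); first by rewrite lee_fin.
rewrite -lne_nat // lee_lne // ?in_itv /= ?leey ?andbT ?covering_number_ge0 //.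
Qed.

Lemma ln_natX (k n : nat) : (0 < k)%N -> ln ((k ^ n)%N%:R : R) = n%:R * ln (k%:R : R).
Proof. by move=> k0; rewrite natrX lnXn ?ltr0n // mulr_natl. Qed.

(** If the conclusion failed, every relatively open piece of [E] in [O] would contain a smaller
    ball, centred in [E], missing the next [F i]. The nested balls would have a common point in the
    compact [E], lying in no [F i]. The sets [F i] need not be closed, so the conclusion is density
    rather than containment. *)
Lemma compact_baire (E O : set 'rV[R]_d) (F : nat -> set 'rV[R]_d) :
  compact E -> open O -> E `&` O !=set0 -> E `<=` \bigcup_i F i ->
  exists i e (r : R), [/\ E e, 0 < r, (forall x : 'rV[R]_d, `|x - e| < r -> O x) &
    forall e' (delta : R), E e' -> `|e' - e| < r -> 0 < delta ->
      exists2 f, F i f & `|f - e'| <= delta].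
Proof.
move=> Ec Oo [e0 [Ee0 Oe0]] EF; apply: contrapT => nE.
have step (i : nat) (er : 'rV[R]_d * R) : exists er' : 'rV[R]_d * R,
    E er.1 -> 0 < er.2 -> (forall x, `|x - er.1| < er.2 -> O x) ->
    [/\ E er'.1, 0 < er'.2, (forall x, `|x - er'.1| <= er'.2 -> `|x - er.1| < er.2) &
        forall x, `|x - er'.1| <= er'.2 -> ~ F i x].
  case: er => e r /=.
  have [[Ee [r0 rO]]|no] := pselect (E e /\ 0 < r /\ (forall x, `|x - e| < r -> O x)); last first.
    by exists (e, r) => Ee r0 rO; case: no.
  have [e' [delta [Ee' e'r delta0 hF]]] : exists e' (delta : R),
      [/\ E e', `|e' - e| < r, 0 < delta & forall f, F i f -> delta < `|f - e'|].
    apply: contrapT => no; apply: nE; exists i, e, r; split => // e' delta Ee' e'r delta0.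
    apply: contrapT => nf; apply: no; exists e', delta; split => // f Ff.
    by rewrite ltNge; apply/negP => fe; apply: nf; exists f.
  have re : 0 < r - `|e' - e| by rewrite subr_gt0.
  (* [delta] keeps the closed ball away from [F i]; half of the remaining room keeps it inside the
     previous open ball. *)
  exists (e', Num.min delta ((r - `|e' - e|) / 2)) => _ _ _ /=; split => //.
  - by rewrite lt_min delta0 divr_gt0.
  - move=> x; rewrite le_min => /andP[_ xe]; apply: le_lt_trans (ler_distD e' _ _) _.
    by lra.
  - by move=> x; rewrite le_min => /andP[xd _] /hF; rewrite ltNge xd.
have [r0 r00 r0O] : exists2 r0 : R, 0 < r0 & forall x, `|x - e0| < r0 -> O x.
  have := Oo _ Oe0; rewrite -nbhs_ballE => -[r r0 rO]; exists r => // x xr.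
  by apply: rO; rewrite -ball_normE /= distrC.
have [nxt hnxt] := choice (fun q : nat * ('rV[R]_d * R) => step q.1 q.2).
pose s := fix s k := if k is k'.+1 then nxt (k', s k') else (e0, r0).
have sP k : [/\ E (s k).1, 0 < (s k).2 & forall x, `|x - (s k).1| < (s k).2 -> O x].
  elim: k => [//|k [Es s0 sO]]; have [E' s0' sin _] := hnxt (k, s k) Es s0 sO.
  by split => // x xs; apply/sO/sin/ltW.
have sN k : (forall x, `|x - (s k.+1).1| <= (s k.+1).2 -> `|x - (s k).1| < (s k).2) /\
    forall x, `|x - (s k.+1).1| <= (s k.+1).2 -> ~ F k x.
  by have [Es s0 sO] := sP k; have [] := hnxt (k, s k) Es s0 sO.
have snest k m : `|(s (m + k)%N).1 - (s k).1| <= (s k).2.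
  have : forall x, `|x - (s (m + k)%N).1| <= (s (m + k)%N).2 -> `|x - (s k).1| <= (s k).2.
    elim: m => [//|m IHm] x xs; apply: IHm; apply: ltW; exact: (sN (m + k)%N).1.
  by apply; rewrite subrr normr0; have [_ /ltW] := sP (m + k)%N.
have [e [Ee ecl]] : E `&` cluster ((fun k => (s k).1) @ \oo) !=set0.
  by apply: Ec; exists 0%N => // k _; have [] := sP k.
have es k : `|e - (s k).1| <= (s k).2.
  apply/ler_addgt0Pl => eps eps0.
  have tail : ((fun k => (s k).1) @ \oo) [set (s m).1 | m in [set m | (k <= m)%N]].
    by exists k => // m km; exists m.
  have [_ [[m km <-] em]] := ecl _ _ tail (nbhsx_ballx e eps eps0).
  apply: le_trans (ler_distD (s m).1 _ _) _; apply: lerD.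
    by move: em; rewrite -ball_normE => /ltW.
  by rewrite -(subnK km).
by have [i _] := EF e Ee; exact: (sN i).2 (es i.+1).
Qed.

End BoxDimension.

(** * Packing dimension of limits of windows *)

Lemma open_open_unit_cube (R : realType) (d : nat) : open (@open_unit_cube R d).
Proof.
rewrite openE => z zc; rewrite /interior /= -nbhs_ballE /=.
pose r : R := \big[Num.min/1]_(i < d) Num.min (z ord0 i) (1 - z ord0 i).
have r0 : 0 < r.
  rewrite /r; elim/big_ind: _ => // [x y x0 y0|i _]; first by rewrite lt_min x0.
  by have /andP[? ?] := zc i; rewrite lt_min subr_gt0; apply/andP.
exists r => // x [_ zx] i; have := zx ord0 i; rewrite /ball /=.
have : r <= Num.min (z ord0 i) (1 - z ord0 i) by exact: bigmin_le_cond.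
by rewrite le_min ltr_norml => /andP[r1 r2] /andP[r3 r4]; apply/andP; split; lra.
Qed.

Lemma large_mul (R : realType) (C e : R) : 0 < e -> \forall n \near \oo, C <= e * n%:R.
Proof.
move=> e0; exists (Num.truncn `|C / e|).+1 => // n /= nC.
rewrite mulrC -ler_pdivrMr //; apply: le_trans (ler_norm _) _.
have /andP[_ /ltW] := truncn_itv (normr_ge0 (C / e)).
by move=> /le_trans; apply; rewrite ler_nat.
Qed.

Section Dimension.
Context (R : realType) (d : nat) (alpha beta : R) (b : nat -> bool).
Hypotheses (d0 : (0 < d)%N) (alpha0 : 0 <= alpha) (alpha_beta : alpha <= beta)
  (beta1 : beta <= 1).
Context (U : set_system nat) (lam : nat -> R) (u : nat -> 'rV[R]_d) (p : nat -> nat).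
Context (E : set 'rV[R]_d) (b' : nat -> bool) (v : R).
Hypotheses (FU : ProperFilter U) (lam_p : forall j, 2 ^+ p j <= lam j <= 2 ^+ (p j).+1).
Hypotheses (Ec : compact E) (E0 : E `&` @open_unit_cube R d !=set0).
Hypothesis close : forall eps : R, 0 < eps -> U [set j |
  (forall y, window (rate_set alpha beta b) (lam j) (u j) y -> exists2 e, E e & l2dist y e <= eps) /\
  (forall e, E e -> exists2 y, window (rate_set alpha beta b) (lam j) (u j) y & l2dist e y <= eps)].
Hypothesis agree : forall i, U [set j | b (p j + i)%N = b' i].
Hypothesis dens : upper_density b' v.

Let D := rate_set alpha beta b.
Let w := alpha + (beta - alpha) * v.

Let agree_below n : U [set j | forall i, (i < n)%N -> b (p j + i)%N = b' i].
Proof. exact: (near_all_below n _ agree). Qed.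

Let ba1 : beta - alpha <= 1. Proof. by move: alpha0 beta1 => a0 b1; lra. Qed.

Let dR : (0 : R) < d%:R. Proof. by rewrite ltr0n. Qed.

(** One window close enough to [E] and agreeing with [b'] on [n + c] digits suffices; the [c]
    surplus digits and the rounding give the additive constants. *)
Let covering_le c n : 8 * d%:R * 2^-1 ^+ c <= (1 : R) -> exists t : nat,
  (covering_number E n <= (((5 * 2 ^ t) ^ d)%N%:R : R)%:E)%E /\
  t%:R <= alpha * n%:R + (beta - alpha) * (count_below b' n)%:R + c%:R + 1.
Proof.
move=> hc.
have eps0 : 0 < 2^-1 ^+ n / (4 * d%:R) :> R by rewrite divr_gt0 ?exprn_gt0 // mulr_gt0.
have [j /= [[_ hE] bb']] := filter_ex (filterI (close eps0) (agree_below (n + c))).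
have /andP[pl lp] := lam_p j.
have En0 : E !=set0 by have [x []] := E0; exists x.
exists (count_below (fun i => D (p j + i)%N) (n + c)); split.
  exact: (covering_number_window_le d0 En0 pl lp hc hE).
have := count_rate_window b alpha0 alpha_beta beta1 (p j) (n + c).
rewrite (@eq_count_below (fun i => b (p j + i)%N) b' (n + c)) // ler_norml => /andP[_].
rewrite -/D.
have := count_below_le (fun i => b' (n + i)%N) c; rewrite (count_belowD b') -(ler_nat R) !natrD => cc.
set k := (count_below _ n)%:R in cc *; set k' := (count_below _ c)%:R in cc *.
have h1 : (beta - alpha) * k' <= (beta - alpha) * c%:R by rewrite ler_wpM2l ?subr_ge0.
have h2 : beta * c%:R <= c%:R by rewrite ler_piMl.
by lra.
Qed.

Let upper : (upper_box_dim E <= (d%:R * w)%:E)%E.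
Proof.
have [c hc] : exists c : nat, 8 * d%:R * 2^-1 ^+ c <= (1 : R).
  have e0 : 0 < (8 * d%:R)^-1 :> R by rewrite invr_gt0 mulr_gt0.
  have [c _ /(_ c (leqnn c)) /= hc] := half_pow_lt e0; exists c.
  by rewrite mulrC -ler_pdivlMr ?mulr_gt0 // div1r ltW.
apply: upper_box_dim_le => e e0.
have e1 : 0 < e / (2 * d%:R) by rewrite divr_gt0 // mulr_gt0.
have [N dN] := dens.1 _ e1.
have [N' _ hN'] := large_mul (ln 5 / ln 2 + c%:R + 1) e1.
exists (maxn N N') => // n /=; rewrite geq_max => /andP[/dN bn /hN' /= cn].
have [t [ct tn]] := covering_le n hc.
exists ((5 * 2 ^ t) ^ d)%N; split => //; first by rewrite expn_gt0 muln_gt0 expn_gt0.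
rewrite ln_natX ?muln_gt0 ?expn_gt0 // natrM lnM ?posrE ?ltr0n ?expn_gt0 // ln_natX //.
have l2 := ln2_gt0 R.
have -> : ln 5 + t%:R * ln 2 = (ln 5 / ln 2 + t%:R) * ln 2 :> R.
  by rewrite mulrDl divfK ?gt_eqF.
rewrite !mulrA ler_wpM2r ?(ltW l2) //.
have eE : e = d%:R * (e / (2 * d%:R) + e / (2 * d%:R)).
  by field; rewrite gt_eqF.
rewrite {1}eE -mulrDr -mulrA ler_wpM2l ?(ltW dR) //.
set e' := e / _ in cn bn e1 *.
have h1 : (beta - alpha) * (count_below b' n)%:R <= (beta - alpha) * ((v + e') * n%:R).
  by rewrite ler_wpM2l ?subr_ge0.
have h2 : (beta - alpha) * (e' * n%:R) <= e' * n%:R.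
  by apply: ler_piMl => //; rewrite mulr_ge0 // ltW.
by rewrite /w; lra.
Qed.

(** By Baire, some [F i] is dense in a piece of [E] inside the open cube, and every such piece
    already sees all digits of the window after the first [m]. *)
Let lower (F : nat -> set 'rV[R]_d) : E = \bigcup_i F i ->
  exists i, ((d%:R * w)%:E <= upper_box_dim (F i))%E.
Proof.
move=> EF; have EF' : E `<=` \bigcup_i F i by rewrite -EF.
have [i [e [r [Ee r0 rO rF]]]] := compact_baire Ec (@open_open_unit_cube R d) E0 EF'.
exists i; apply: upper_box_dim_ge => eps N eps0.
have r80 : 0 < r / 16 by rewrite divr_gt0.
have [m _ /(_ m (leqnn m)) /= mr] := half_pow_lt r80.
have e1 : 0 < eps / (2 * d%:R) by rewrite divr_gt0 // mulr_gt0.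
(* The constant absorbs the [m] frozen digits, the rounding error 1 and the 2 extra generations in
   the final scale [n' + 2]. *)
have [N' _ hN'] := large_mul (2 * m%:R + 1 + 2 * `|w|) e1.
have [n' nN' bn'] := dens.2 _ (maxn (maxn N N') m) e1.
move: nN'; rewrite !geq_max => /andP[/andP[Nn' /hN' /= n'big] mn'].
have k0 : 0 < Num.min (r / 16) (2^-1 ^+ (m + (n' - m)) / 16).
  by rewrite lt_min r80 divr_gt0 ?exprn_gt0.
have [j /= [[hW hE] bb']] := filter_ex (filterI (close k0) (agree_below n')).
have /andP[pl lp] := lam_p j.
set eta := Num.min _ _ in k0 hW hE.
have eta1 : eta <= r / 16 by rewrite ge_min lexx.
have eta2 : eta <= 2^-1 ^+ (m + (n' - m)) / 16 by rewrite ge_min lexx orbT.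
have nearr (x : 'rV[R]_d) : (forall i, `|x ord0 i - e ord0 i| < r / 2) -> `|x - e| < r.
  move=> h; apply: (@le_lt_trans _ _ (r / 2)); last lra.
  by apply: rV_norm_le => [|k]; rewrite ?mxE ?ltW // divr_gt0.
set t := count_below (fun i => D (p j + m + i)%N) (n' - m).
have cov : ((((2 ^ t) ^ d)%N%:R : R)%:E <= covering_number (F i) (m + (n' - m) + 2))%E.
  apply: (@covering_number_window_ge _ _ _ E _ _ _ e _ _ _ (r / 2) eta pl lp) => //.
  - by lra.
  - by lra.
  - by move=> x /nearr/rO xO k; have /andP[? ?] := xO k; rewrite !ltW.
  - by have [y Wy ye] := hE e Ee; exists y; [exact: Wy|rewrite l2distC].
  - exact: hW.
  - move=> e' Ee' /nearr e'r; have [f Ff fe'] := rF e' eta Ee' e'r k0; exists f => // k.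
    by apply: le_trans fe'; have := rV_coord_le_norm (f - e') k; rewrite !mxE.
rewrite subnKC // in cov.
have ht : alpha * (n' - m)%:R + (beta - alpha) * (count_below (fun i => b' (m + i)%N) (n' - m))%:R - 1
    <= t%:R.
  have := count_rate_window b alpha0 alpha_beta beta1 (p j + m) (n' - m).
  rewrite -/D -/t (@eq_count_below (fun i => b (p j + m + i)%N) (fun i => b' (m + i)%N) (n' - m)); last first.
    by move=> k kn; rewrite -addnA bb' // -ltn_subRL.
  by rewrite ler_norml => /andP[? _]; lra.
clearbody t; exists (n' + 2)%N, ((2 ^ t) ^ d)%N; split; [|by rewrite !expn_gt0|exact: cov|].
  exact: leq_trans Nn' (leq_addr _ _).
rewrite ln_natX ?expn_gt0 // ln_natX //.
have l2 := ln2_gt0 R.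
rewrite !mulrA ler_wpM2r ?(ltW l2) //.
have := count_belowD b' m (n' - m); rewrite subnKC // => /(congr1 (fun k => k%:R : R)).
rewrite natrD => cE; have := count_below_le b' m; rewrite -(ler_nat R) => cm.
rewrite natrB // in ht.
set k := (count_below (fun i => _) _)%:R in ht cE; set k' := (count_below b' m)%:R in cE cm.
have h1 : (beta - alpha) * ((v - eps / (2 * d%:R)) * n'%:R) <= (beta - alpha) * (k' + k).
  by rewrite ler_wpM2l ?subr_ge0 // -cE.
have h2 : (beta - alpha) * k' <= (beta - alpha) * m%:R by rewrite ler_wpM2l ?subr_ge0.
set e' := eps / _ in bn' n'big e1 h1.
have h3 : (beta - alpha) * (e' * n'%:R) <= e' * n'%:R.
  by apply: ler_piMl => //; rewrite mulr_ge0 // ltW.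
have h4 : beta * m%:R <= m%:R by rewrite ler_piMl.
have tw : (w - e') * n'%:R - m%:R - 1 <= t%:R by rewrite /w; lra.
have eE : eps = d%:R * (e' + e') by rewrite /e'; field; rewrite gt_eqF.
rewrite {1}eE -mulrBr -mulrA ler_wpM2l ?(ltW dR) //.
rewrite natrD; have := ler_norm w; have : 0 <= m%:R :> R by [].
by lra.
Qed.

(** The constant decomposition gives the upper bound; in any other, [lower] finds a piece of full
    upper box dimension. *)
Lemma packing_dim_window : packing_dim E = (d%:R * w)%:E.
Proof.
apply/eqP; rewrite eq_le; apply/andP; split.
  apply: ge_ereal_inf; exists (ereal_sup (range (fun _ : nat => upper_box_dim E))).
    exists (fun _ : nat => E) => //; apply/seteqP; split=> [x Ex|x [_ _]//].
    by exists 0%N.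
  by apply: ge_ereal_sup => _ [_ _ <-].
apply: le_ereal_inf_tmp => _ [F EF <-]; have [i hi] := lower EF.
by apply: ereal_sup_ge; exists (upper_box_dim (F i)) => //; exists i.
Qed.

End Dimension.

(** * Hausdorff limits along an ultrafilter *)

Section Hausdorff.
Context (R : realType) (d : nat).
Implicit Types A B E : set 'rV[R]_d.

Let has_inf_dist A (x : 'rV[R]_d) : A !=set0 -> has_inf [set l2dist x a | a in A].
Proof.
move=> [a Aa]; split; first by exists (l2dist x a), a.
by exists 0 => _ [c _ <-]; exact: l2dist_ge0.
Qed.

Let dist_setC A B : [set inf [set l2dist a b | a in A] | b in B] =
  [set inf [set l2dist b a | a in A] | b in B].
Proof.
apply: eq_imagel => b _; congr inf.
by apply: eq_imagel => a _; rewrite l2distC.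
Qed.

(** The bound [M] makes the set of distances bounded above, so that the real [sup] is a genuine
    supremum. *)
Lemma one_sided_close A B (M eps : R) : B !=set0 ->
  (forall a b, A a -> B b -> l2dist a b <= M) ->
  sup [set inf [set l2dist a b | b in B] | a in A] < eps ->
  forall a, A a -> exists2 b, B b & l2dist a b < eps.
Proof.
move=> B0 AB supe a Aa; have [b0 Bb0] := B0.
have infe : inf [set l2dist a b | b in B] < eps.
  apply: le_lt_trans supe; apply: ub_le_sup; last by exists a.
  exists M => _ [a' Aa' <-]; apply: le_trans (AB a' b0 Aa' Bb0).
  by apply: ge_inf; [have [] := has_inf_dist a' B0 | exists b0].
have [//|_ [b Bb <-] be] := inf_lt _ infe; first by exists (l2dist a b0), b0.
by exists b.
Qed.

Lemma hausdorff_dist_close A B (M eps : R) : A !=set0 -> B !=set0 ->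
  (forall a b, A a -> B b -> l2dist a b <= M) -> hausdorff_dist A B < eps ->
  (forall a, A a -> exists2 b, B b & l2dist a b < eps) /\
  (forall b, B b -> exists2 a, A a & l2dist b a < eps).
Proof.
move=> A0 B0 AB; rewrite /hausdorff_dist gt_max => /andP[h1 h2]; split.
  exact: one_sided_close B0 AB h1.
apply: (@one_sided_close B A M eps A0); last by rewrite -dist_setC.
by move=> b a Bb Aa; rewrite l2distC; exact: AB.
Qed.

Lemma one_sided_le A B (eps : R) : A !=set0 ->
  (forall a, A a -> exists2 b, B b & l2dist a b <= eps) ->
  sup [set inf [set l2dist a b | b in B] | a in A] <= eps.
Proof.
move=> [a0 Aa0] AB; apply: ge_sup; first by exists (inf [set l2dist a0 b | b in B]), a0.
move=> _ [a Aa <-]; have [b Bb ab] := AB a Aa; apply: le_trans ab.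
by apply: ge_inf; [have [] := has_inf_dist a (ex_intro _ b Bb) | exists b].
Qed.

Lemma hausdorff_dist_le A B (eps : R) : A !=set0 -> B !=set0 ->
  (forall a, A a -> exists2 b, B b & l2dist a b <= eps) ->
  (forall b, B b -> exists2 a, A a & l2dist b a <= eps) -> hausdorff_dist A B <= eps.
Proof.
move=> A0 B0 AB BA; rewrite /hausdorff_dist ge_max (one_sided_le A0 AB) dist_setC.
exact: one_sided_le B0 BA.
Qed.

Lemma hausdorff_dist_ge0 A B : A !=set0 -> B !=set0 -> 0 <= hausdorff_dist A B.
Proof.
move=> [a Aa] [b Bb]; rewrite le_max; apply/orP; left.
(* On an unbounded set [sup] takes its default value 0. *)
have [[_ hs]|/sup_out -> //] := pselect (has_sup [set inf [set l2dist a b | b in B] | a in A]).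
apply: (@le_trans _ _ (inf [set l2dist a b | b in B])); last by apply: ub_le_sup => //; exists a.
by apply: lb_le_inf; [exists (l2dist a b), b | move=> _ [c _ <-]; exact: l2dist_ge0].
Qed.

Lemma compact_unit_cube : compact (@unit_cube R d).
Proof.
apply: bounded_closed_compact.
  exists 1; split; first exact: num_real.
  move=> M M1 z zc /=; apply: rV_norm_le => [|i]; first lra.
  by rewrite ler_norml; have /andP[? ?] := zc i; apply/andP; split; lra.
move=> z zc i; apply/andP; split; apply/ler_addgt0Pl => /= e e0;
  have [x [/(_ i)/andP[x0 x1] [_ /(_ ord0 i)]]] := zc _ (nbhsx_ballx z e e0);
  rewrite /ball /= ltr_norml => /andP[? ?]; lra.
Qed.

Lemma l2dist_bounded E : compact E -> exists M : R,
  forall a b, @unit_cube R d a -> E b -> l2dist a b <= M.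
Proof.
move=> /compact_bounded [M [_ hM]]; exists (d%:R * (1 + (`|M| + 1))) => a b ac Eb.
apply: l2dist_le => [|i]; first by have := normr_ge0 M; lra.
apply: le_trans (ler_normB _ _) _; apply: lerD.
  by rewrite ler_norml; have /andP[? ?] := ac i; apply/andP; split; lra.
apply: le_trans (rV_coord_le_norm b i) _; apply: hM => //.
by have := ler_norm M; lra.
Qed.

(** For non-empty subsets of the cube this is their Hausdorff limit along an ultrafilter, which
    replaces the extraction of convergent subsequences. *)
Definition set_ulim (U : set_system nat) (X : nat -> set 'rV[R]_d) : set 'rV[R]_d :=
  [set z | forall eps : R, 0 < eps -> U [set j | exists2 x, X j x & `|x - z| < eps]].

Section UltraLimit.
Context (U : set_system nat) (X : nat -> set 'rV[R]_d).
Hypotheses (UU : UltraFilter U) (Xcube : forall j, X j `<=` @unit_cube R d).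
Hypothesis X0 : forall j, X j !=set0.

Let E := set_ulim U X.

Lemma compact_set_ulim : compact E.
Proof.
have FU : ProperFilter U by exact: ultra_proper.
apply: bounded_closed_compact.
  exists 2; split; first exact: num_real.
  move=> M M2 z /(_ 1 ltr01) /filter_ex[j [x Xx xz]] /=.
  apply: rV_norm_le => [|i]; first lra.
  have /andP[x0 x1] := Xcube Xx i.
  have := le_lt_trans (rV_coord_le_norm (x - z) i) xz; rewrite !mxE ltr_norml ler_norml.
  by move=> /andP[? ?]; apply/andP; split; lra.
move=> z zc eps eps0; have e20 : 0 < eps / 2 by rewrite divr_gt0.
have [y [Ey zy]] := zc _ (nbhsx_ballx z _ e20).
apply: filterS (Ey _ e20) => j [x Xx xy]; exists x => //.
move: zy; rewrite -ball_normE /= => zy; apply: le_lt_trans (ler_distD y _ _) _.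
by rewrite (distrC y); lra.
Qed.

Lemma cluster_set_ulim (y : nat -> 'rV[R]_d) : U [set j | X j (y j)] ->
  exists2 e, E e & forall S (eps : R), U S -> 0 < eps -> exists2 j, S j & `|y j - e| < eps.
Proof.
move=> Uy; have FU : ProperFilter U by exact: ultra_proper.
have [e [_ ecl]] : @unit_cube R d `&` cluster (y @ U) !=set0.
  apply: compact_unit_cube; change (U (y @^-1` @unit_cube R d)).
  by apply: filterS Uy => j; exact: Xcube.
have ecl' S (eps : R) : U S -> 0 < eps -> exists2 j, S j & `|y j - e| < eps.
  move=> US eps0; have yS : (y @ U) [set y j | j in S].
    by change (U (y @^-1` [set y j | j in S])); apply: filterS US => j Sj; exists j.
  have [_ [[j Sj <-] je]] := ecl _ _ yS (nbhsx_ballx e eps eps0); exists j => //.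
  by move: je; rewrite -ball_normE /= distrC.
exists e => // eps eps0; have [//|Un] := in_ultra_setVsetC [set j | exists2 x, X j x & `|x - e| < eps] UU.
have [j [/= Xj nj] je] := ecl' _ eps (filterI Uy Un) eps0.
by case: nj; exists (y j).
Qed.

(** If either half failed, it would fail on a set of [U]. Bad points chosen there accumulate, by
    compactness, at a point of [E], and so become close to [E], respectively to [X j]. *)
Lemma set_ulim_close (eps : R) : 0 < eps -> U [set j |
  (forall y, X j y -> exists2 e, E e & l2dist y e <= eps) /\
  (forall e, E e -> exists2 y, X j y & l2dist e y <= eps)].
Proof.
move=> eps0; have FU : ProperFilter U by exact: ultra_proper.
have dd : (0 : R) < 2 * (d%:R + 1) by rewrite mulr_gt0 // addr_gt0.
have dlt0 : 0 < eps / (2 * (d%:R + 1)) by rewrite divr_gt0.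
set dlt := eps / _ in dlt0.
have dltE : d%:R * (2 * dlt) <= eps.
  have epsE : eps = (d%:R + 1) * (2 * dlt).
    by rewrite /dlt; field; rewrite gt_eqF // ltr_wpDl.
  by rewrite [leRHS]epsE ler_wpM2r ?lerDl // mulr_ge0 // ltW.
have norm_l2 (x y : 'rV[R]_d) : `|x - y| <= 2 * dlt -> l2dist x y <= eps.
  move=> xy; apply: le_trans dltE; apply: l2dist_le => [|i]; first by rewrite mulr_ge0 // ltW.
  by apply: le_trans xy; have := rV_coord_le_norm (x - y) i; rewrite !mxE.
apply: filterI.
  have [//|Un] := in_ultra_setVsetC [set j | forall y, X j y -> exists2 e, E e & l2dist y e <= eps] UU.
  have /choice[y hy] : forall j, exists y, X j y /\
      ((~ forall y, X j y -> exists2 e, E e & l2dist y e <= eps) ->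
       ~ exists2 e, E e & l2dist y e <= eps).
    move=> j; have [H|/existsNP[y /not_implyP[Xy ny]]] :=
      pselect (forall y, X j y -> exists2 e, E e & l2dist y e <= eps); last by exists y.
    by have [y Xy] := X0 j; exists y; split.
  have [|e Ee ecl] := @cluster_set_ulim y; first by apply: filterE => j; have [] := hy j.
  have [j nj je] := ecl _ dlt Un dlt0; have [_ /(_ nj)] := hy j; case.
  by exists e => //; apply: norm_l2; lra.
have [//|Un] := in_ultra_setVsetC [set j | forall e, E e -> exists2 y, X j y & l2dist e y <= eps] UU.
have [e0 Ee0] : E !=set0.
  have [y hy] := choice X0; have [|e Ee _] := @cluster_set_ulim y; first exact: filterE.
  by exists e.
have /choice[y hy] : forall j, exists y, E y /\
    ((~ forall e, E e -> exists2 y, X j y & l2dist e y <= eps) ->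
     ~ exists2 x, X j x & l2dist y x <= eps).
  move=> j; have [H|/existsNP[y /not_implyP[Ey ny]]] :=
    pselect (forall e, E e -> exists2 y, X j y & l2dist e y <= eps); last by exists y.
  by exists e0; split.
have [e [Ee ecl]] : E `&` cluster (y @ U) !=set0.
  apply: compact_set_ulim; change (U (y @^-1` E)).
  by apply: filterE => j /=; have [] := hy j.
have yS : (y @ U) [set y j | j in
    [set j | ~ forall e, E e -> exists2 y, X j y & l2dist e y <= eps] `&`
    [set j | exists2 x, X j x & `|x - e| < dlt]].
  match goal with |- _ ?S => change (U (y @^-1` S)) end.
  by apply: filterS (filterI Un (Ee _ dlt0)) => j Sj; exists j.
have [_ [[j [nj [x Xx xe]] <-] je]] := ecl _ _ yS (nbhsx_ballx e _ dlt0).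
have [_ /(_ nj)] := hy j; case; exists x => //; apply: norm_l2.
move: je; rewrite -ball_normE /= => je.
by apply: le_trans (ler_distD e _ _) _; rewrite (distrC (y j)) (distrC e x); lra.
Qed.

End UltraLimit.

End Hausdorff.

(** * Microsets of the digit set *)

Lemma dyadic_scale (R : realType) (x : R) : 1 <= x -> exists p : nat, 2 ^+ p <= x <= 2 ^+ p.+1.
Proof.
move=> x1; have [n xn] : exists n : nat, x < 2 ^+ n.
  exists (Num.truncn x).+1; have /andP[_ xlt] := truncn_itv (le_trans ler01 x1).
  by apply: lt_trans xlt _; rewrite -natrX ltr_nat ltn_expl.
elim: n xn => [|n IHn] xn; first by rewrite expr0 ltNge x1 in xn.
by have [/IHn//|nx] := ltP x (2 ^+ n); exists n; rewrite nx ltW.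
Qed.

Section Microsets.
Context (R : realType) (d : nat) (alpha beta : R) (b : nat -> bool).
Hypotheses (d0 : (0 < d)%N) (alpha0 : 0 <= alpha) (alpha_beta : alpha <= beta)
  (beta1 : beta <= 1).

Let K : set 'rV[R]_d := digit_set (rate_set alpha beta b).

(** Along an ultrafilter refining infinity, every digit of the shifted words stabilises, which
    defines the limit word. [P] stands for whatever is known about the densities of such limits. *)
Lemma microset_packing_dim (P : R -> Prop) E :
  (forall (U : set_system nat) (p : nat -> nat) (b' : nat -> bool), UltraFilter U ->
     (forall i, U [set j | b (p j + i)%N = b' i]) -> exists2 v : R, upper_density b' v & P v) ->
  is_microset K E ->
  exists2 v : R, P v & packing_dim E = (d%:R * (alpha + (beta - alpha) * v))%:E.
Proof.
move=> hP [Ec E0 [lam [u [lam1 KS0 cvg0]]]].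
have [U [UU oU]] := @ultraFilterLemma _ (\oo : set_system nat) _.
have FU : ProperFilter U by exact: ultra_proper.
have [p hp] := choice (fun j => dyadic_scale (lam1 j)).
pose b' i := `[< U [set j | b (p j + i)%N] >].
have hb' i : U [set j | b (p j + i)%N = b' i].
  rewrite /b'; case: asboolP => [|nU]; first by apply: filterS => j /= ->.
  have [//|] := in_ultra_setVsetC [set j | b (p j + i)%N] UU.
  by apply: filterS => j /= /negP/negbTE.
have [v dv Pv] := hP U p b' UU hb'; exists v => //.
apply: (@packing_dim_window _ _ _ _ b d0 alpha0 alpha_beta beta1 U lam u p _ b') => //.
move=> eps eps0; have [M hM] := l2dist_bounded Ec.
apply: oU; move/cvgrPdist_lt: cvg0 => /(_ eps eps0); apply: filterS => j.
rewrite sub0r normrN => /(le_lt_trans (ler_norm _)) he.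
have E00 : E !=set0 by have [x []] := E0; exists x.
have bounded a c (KSa : window (rate_set alpha beta b) (lam j) (u j) a) (Ecc : E c) :
    l2dist a c <= M by exact: hM KSa.2 Ecc.
have [h1 h2] := hausdorff_dist_close (KS0 j) E00 bounded he.
split=> [y /h1[e Ee ye]|e /h2[y Wy ey]]; first by exists e => //; exact: ltW.
by exists y => //; exact: ltW.
Qed.

Lemma microset_exists (p : nat -> nat) (b' : nat -> bool) (v : R) :
  (forall i, \forall r \near \oo, b (p r + i)%N = b' i) -> upper_density b' v ->
  exists2 E, is_microset K E & packing_dim E = (d%:R * (alpha + (beta - alpha) * v))%:E.
Proof.
move=> hb' dv; have [U [UU oU]] := @ultraFilterLemma _ (\oo : set_system nat) _.
have FU : ProperFilter U by exact: ultra_proper.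
(* This translation sends the point 0 of the digit set to the centre of the cube, so the limit meets
   the open cube. *)
pose c : 'rV[R]_d := const_mx 2^-1.
pose X j : set 'rV[R]_d := window (rate_set alpha beta b) (2 ^+ p j) c.
have half1 : (2^-1 : R) < 1 by lra.
have Xc j : X j c.
  split; last by move=> i; rewrite mxE invr_ge0 ler0n ltW.
  by exists 0; [exact: digit_set0 | rewrite scaler0 add0r].
have X0 j : X j !=set0 by exists c.
have Xcube j : X j `<=` @unit_cube R d by move=> x [].
have Ec := compact_set_ulim UU Xcube; set E := set_ulim U X in Ec.
have Ecc : E c by move=> eps eps0; apply: filterE => j; exists c => //; rewrite subrr normr0.
have E0 : E `&` @open_unit_cube R d !=set0 by exists c; split => // i; rewrite mxE invr_gt0 ltr0n half1.
have close := set_ulim_close UU Xcube X0.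
exists E; last first.
  apply: (@packing_dim_window _ _ _ _ b d0 alpha0 alpha_beta beta1 U (fun j => 2 ^+ p j) (fun=> c) p _ b') => //.
  - by move=> j; rewrite lexx /= exprS ler_peMl ?exprn_ge0 // ler1n.
  - by move=> i; apply: oU; exact: hb'.
split => //.
(* Closeness along the ultrafilter yields an honest sequence of windows with distances at most
   2^-k. *)
have /choice[j hj] : forall k : nat, exists j, hausdorff_dist (X j) E <= 2^-1 ^+ k.
  move=> k; have [j [h1 h2]] := filter_ex (close _ (exprn_gt0 k (ltac:(by []) : (0 : R) < 2^-1))).
  by exists j; apply: hausdorff_dist_le => //; exists c.
exists (fun k => 2 ^+ p (j k)), (fun=> c) => KS; split => [k|k|].
- by rewrite exprn_ege1 // ler1n.
- exact: X0.
- apply/cvgrPdist_lt => e e0; apply: filterS (half_pow_lt e0) => k ke.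
  rewrite sub0r normrN ger0_norm; first exact: le_lt_trans (hj k) ke.
  by apply: hausdorff_dist_ge0; [exact: X0 | exists c].
Qed.

End Microsets.

Theorem corollary1p7 (R : realType) (d : nat) (hd : (1 <= d)%N) (A : set R)
    (hA : A `<=` [set x | 0 <= x <= d%:R]) (hA0 : A !=set0)
    (hAan : analytic A) (hinf : A (inf A)) (hsup : A (sup A)) :
  exists2 K : set 'rV[R]_d, compact K &
    [set packing_dim E | E in microsets K] = [set x%:E | x in A].
Proof.
have [a [aA a_cvg a_onto]] := analytic_scheme hA0 hAan.
have infA x : A x -> inf A <= x.
  by move=> Ax; apply: ge_inf => //; exists 0 => y /hA/andP[].
have supA x : A x -> x <= sup A.
  by move=> Ax; apply: ub_le_sup => //; exists d%:R => y /hA/andP[].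
have dR : (0 : R) < d%:R by rewrite ltr0n.
have /andP[inf0 _] := hA _ hinf; have /andP[_ supd] := hA _ hsup.
have inf_sup : inf A <= sup A by exact: infA.
(* Rescales [A] to [0, 1]. If [A] is a single point the division by 0 gives 0, and [gK] still
   holds. *)
pose g x : R := (x - inf A) / (sup A - inf A).
have gK x : A x -> inf A + (sup A - inf A) * g x = x.
  move=> Ax; have [e|ne] := eqVneq (sup A) (inf A).
    have -> : x = inf A by apply/eqP; rewrite eq_le infA // -{1}e supA.
    by rewrite /g subrr mul0r mulr0 addr0.
  by rewrite /g mulrC divfK ?subr_eq0 // addrC subrK.
pose v w := g (a w).
have v01 w : 0 <= v w <= 1.
  rewrite /v /g divr_ge0 ?subr_ge0 ?infA //=.
  have [e|ne] := eqVneq (sup A) (inf A); first by rewrite e subrr invr0 mulr0.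
  rewrite ler_pdivrMr ?mul1r ?lerB ?supA //.
  by rewrite subr_gt0 lt_neqAle eq_sym ne.
have v_lim x l : a (prefix_code x r) @[r --> \oo] --> l ->
    v (prefix_code x r) @[r --> \oo] --> g l.
  by move=> al; apply: cvgMl; apply: cvgB => //; exact: cvg_cst.
have v_cvg x : exists l : R, v (prefix_code x r) @[r --> \oo] --> l.
  by have [l _ /v_lim] := a_cvg x; exists (g l).
pose b := block_word v.
pose alpha := inf A / d%:R; pose beta := sup A / d%:R.
have alpha0 : 0 <= alpha by rewrite divr_ge0.
have alpha_beta : alpha <= beta by rewrite ler_wpM2r ?invr_ge0.
have beta1 : beta <= 1 by rewrite ler_pdivrMr // mul1r.
have dimE l : d%:R * (alpha + (beta - alpha) * l) = inf A + (sup A - inf A) * l.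
  by rewrite /alpha /beta; field; rewrite gt_eqF.
exists (digit_set (rate_set alpha beta b)); first exact: compact_digit_set.
apply/seteqP; split => [_ [E mE <-]|_ [x Ax <-]].
  have [l hl ->] := @microset_packing_dim _ d alpha beta b hd alpha0 alpha_beta beta1
    (fun l => [\/ l = 0, l = 1 | exists x, v (prefix_code x r) @[r --> \oo] --> l]) E
    (fun U p b' UU => @block_limit _ v v01 v_cvg U p b' UU) mE.
  (* Limit densities 0 and 1 give the infimum and the supremum of [A], which belong to [A] by
     hypothesis. *)
  rewrite dimE; case: hl => [->|->|[x vl]].
  - by exists (inf A); rewrite // mulr0 addr0.
  - by exists (sup A); rewrite // mulr1 addrC subrK.
  - have [l' Al' /v_lim al'] := a_cvg x.
    have lE : l = g l' := cvg_unique (@Rhausdorff R) vl al'.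
    by exists l' => //; rewrite lE gK.
have [y /v_lim vy] := a_onto x Ax.
have [p hp] := block_realize v01 y.
have [E mE dE] := microset_exists hd alpha0 alpha_beta beta1 hp (upper_density_inf_word v01 vy).
by exists E => //; rewrite dE dimE gK.
Qed.
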